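(* There is, up to isomorphism, exactly one semi-simplicial cup-$i$ construction that is non-zero, irreducible and free. Furthermore, it is simplicial.
   Context: **Chains.** $\mathbb{F}_2$ is the field with two elements. A semi-simplicial set is a contravariant functor from the injective simplex category to sets (a simplicial set without degeneracies). For a semi-simplicial set $X$, $N(X)$ is the chain complex over $\mathbb{F}_2$ with basis the simplices of $X$ and the usual boundary; for a simplicial set, $N(X)$ denotes normalized chains (modulo degenerate simplices). $N^\vee(X)=\mathrm{Hom}(N(X),\mathbb{F}_2)$ is graded homologically, so it is concentrated in non-positive degrees. $\Delta^n$ is the standard $n$-simplex, with face simplices the non-empty subsets of $\{0,\dots,n\}$; $N(\Delta^n)$ is the same complex in the semi-simplicial and (normalized) simplicial settings. Simplices are identified with the corresponding basis elements of chains and (dual) cochains; $|x|$ denotes the dimension of a simplex $x$. **Cup-$i$ structures.** Let $\mathbb{S}_2$ be the group with one non-identity element $T$ and let $W$ be the complex with $W_i=\mathbb{F}_2[\mathbb{S}_2]\{e_i\}$, $i\ge 0$, and $\partial e_i=(1+T)e_{i-1}$. Its automorphisms $\phi$ (as a complex of $\mathbb{F}_2[\mathbb{S}_2]$-modules) are determined by arbitrary choices $\phi(e_i)\in\{e_i,Te_i\}$. A cup-$i$ product structure on a chain complex $A$ is a chain map $W\otimes_{\mathbb{F}_2[\mathbb{S}_2]}A^{\otimes 2}\to A$, where $T$ acts by transposition on $A^{\otimes2}$ and by right multiplication on $W$; the image of $e_i\otimes\alpha\otimes\beta$ is written $\alpha\smile_i\beta$. An isomorphism between two cup-$i$ product structures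 on $A$ is an automorphism $\phi$ of $W$ such that precomposing one structure map with $\phi\otimes\mathrm{id}$ gives the other. **Constructions.** A semi-simplicial (resp. simplicial) cup-$i$ construction is a cup-$i$ product structure on $N^\vee(X)$ for every semi-simplicial (resp. simplicial) set $X$, natural with respect to semi-simplicial (resp. simplicial) maps. An isomorphism of constructions is a family of cup-$i$ isomorphisms, one for each $X$, natural in $X$ (so given by one common automorphism of $W$). A semi-simplicial construction is determined by its restriction to the standard simplices $\Delta^n$; it is called simplicial if it is moreover compatible with degeneracies, i.e. the cup-$i$ product structures on $N^\vee(\Delta^n)$, $n\ge0$, are natural with respect to all maps of the simplex category, including codegeneracies acting on normalized cochains. **Axioms.** The zero construction assigns the zero map to every $X$; any other is non-zero. A semi-simplicial cup-$i$ construction is irreducible if for all $i,N\ge0$ and any simplex $x$ of $\Delta^N$, $(y^{(1)}\smile_i y^{(2)})(x)=0$ whenever $y$ is a proper face of $x$ and $y^{(1)},y^{(2)}$ are faces of $y$. It is free if for all $i,N\ge0$ and any simplices $x,x'$ of $\Delta^N$ with $|x|\ne i$ or $|x'|\neq i$, the equality $x\smile_i x'=x'\smile_i x$ implies $x\smile_i x'=0$. *)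

(* Defs.v *)
From HB Require Import structures.
From mathcomp Require Import all_boot all_order all_algebra.
From mathcomp Require Import boolp functions zify.
Set Implicit Arguments.
Unset Strict Implicit.
Unset Printing Implicit Defensive.
Import GRing.Theory.
Local Open Scope ring_scope.

(* ('F_2)^o is 'F_2 regarded as a module over itself. *)
Notation F2 := (('F_2)^o)%type.

(* The maps [m] -> [n] of the injective simplex category, where
   [n] = {0, ..., n} is 'I_n.+1, are the elements of incr m n below. *)

Definition is_incr m n (f : {ffun 'I_m.+1 -> 'I_n.+1}) : bool :=
  [forall i : 'I_m.+1, forall j : 'I_m.+1, (i < j)%N ==> (f i < f j)%N].

Record incr (m n : nat) := Incr {
  incr_fun :> {ffun 'I_m.+1 -> 'I_n.+1};
  incr_prop : is_incr incr_fun }.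

HB.instance Definition _ m n := [isSub for @incr_fun m n].
HB.instance Definition _ m n := [Finite of incr m n by <:].

Lemma is_incrP m n (f : {ffun 'I_m.+1 -> 'I_n.+1}) :
  reflect (forall i j : 'I_m.+1, (i < j)%N -> (f i < f j)%N) (is_incr f).
Proof.
apply: (iffP forallP) => [H i j|H i]; first exact/implyP/(forallP (H i)).
by apply/forallP => j; apply/implyP; apply: H.
Qed.

Lemma incr_id_subproof n : is_incr [ffun i : 'I_n.+1 => i].
Proof. by apply/is_incrP => i j; rewrite !ffunE. Qed.

Definition incr_id n : incr n n := Incr (incr_id_subproof n).

Lemma incr_comp_subproof l m n (f : incr m n) (g : incr l m) :
  is_incr [ffun i => f (g i)].
Proof.
apply/is_incrP => i j lij; rewrite !ffunE.
exact/(is_incrP _ (incr_prop f))/(is_incrP _ (incr_prop g)).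
Qed.

Definition incr_comp l m n (f : incr m n) (g : incr l m) : incr l n :=
  Incr (incr_comp_subproof f g).

Lemma coface_subproof n (i : 'I_n.+2) : is_incr [ffun k : 'I_n.+1 => lift i k].
Proof.
apply/is_incrP => j k; rewrite !ffunE /= /bump.
by case: leqP; case: leqP => /=; lia.
Qed.

(* The map [n] -> [n+1] whose image misses i. *)
Definition coface n (i : 'I_n.+2) : incr n n.+1 := Incr (coface_subproof i).

Record semiSimplicialSet := SemiSimplicialSet {
  simp :> nat -> Type;
  act : forall m n, incr m n -> simp n -> simp m;
  act_id : forall n (x : simp n), act (incr_id n) x = x;
  act_comp : forall l m n (f : incr m n) (g : incr l m) (x : simp n),
    act (incr_comp f g) x = act g (act f x) }.

Record semiSimplicialMap (X Y : semiSimplicialSet) := SemiSimplicialMap {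
  smap :> forall n, X n -> Y n;
  smap_act : forall m n (g : incr m n) (x : X n),
    smap (act g x) = act g (smap x) }.

Lemma incr_comp1 m n (x : incr m n) : incr_comp x (incr_id m) = x.
Proof. by apply/val_inj/ffunP => i; rewrite !ffunE. Qed.

Lemma incr_compA k l m n (x : incr m n) (f : incr l m) (g : incr k l) :
  incr_comp x (incr_comp f g) = incr_comp (incr_comp x f) g.
Proof. by apply/val_inj/ffunP => i; rewrite !ffunE. Qed.

(* The standard simplex Delta^N, as a representable functor. *)
Definition stdSimplex (N : nat) : semiSimplicialSet :=
  @SemiSimplicialSet (fun n => incr n N)
    (fun m n (g : incr m n) (x : incr n N) => incr_comp x g)
    (fun n x => incr_comp1 x)
    (fun l m n f g x => incr_compA x f g).

(* The face of Delta^N, as a non-empty subset of {0, ..., N}, given by x. *)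
Definition vertices N n (x : stdSimplex N n) : {set 'I_N.+1} :=
  [set (x : incr n N) i | i : 'I_n.+1].

(* Chain complexes in non-positive degrees, graded cohomologically: the
   module in index n is the one in homological degree -n. *)

Record cochainComplex := CochainComplex {
  cmod :> nat -> lmodType 'F_2;
  cdiff : forall n, {linear cmod n -> cmod n.+1};
  cdiffK : forall n (a : cmod n), cdiff n.+1 (cdiff n a) = 0 }.

Arguments cdiff {c n}.

(* Homogeneous components of the differential of an element of A given by its
   homogeneous components. *)
Definition dcomp (A : cochainComplex) (c : forall n, A n) (n : nat) : A n :=
  match n with 0 => 0 | m.+1 => cdiff (c m) end.

(* The complex N^vee(X).  A linear form on the module with basis X n is
   given by its values on the simplices in X n. *)

Section Cochains.
Variable X : semiSimplicialSet.

Definition coboundary n (a : X n -> F2) : X n.+1 -> F2 :=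
  fun x => \sum_(i < n.+2) a (act (coface i) x).

Lemma coboundary_linear n : linear (@coboundary n).
Proof.
move=> k a b; apply/funext => x.
rewrite /coboundary -[RHS]/(k *: \sum_(i < n.+2) a (act (coface i) x) +
  \sum_(i < n.+2) b (act (coface i) x)).
by rewrite scaler_sumr -big_split.
Qed.

HB.instance Definition _ n :=
  GRing.isLinear.Build 'F_2 (X n -> F2) (X n.+1 -> F2) *:%R (@coboundary n)
    (@coboundary_linear n).

Lemma coface_coface n (i : 'I_n.+2) (j : 'I_n.+3) (i' : 'I_n.+2) (j' : 'I_n.+3) :
  (i < j)%N -> i' = (j.-1)%N :> nat -> j' = i :> nat ->
  incr_comp (coface j) (coface i) = incr_comp (coface j') (coface i').
Proof.
move=> lij ei ej; apply/val_inj/ffunP => k; rewrite !ffunE; apply/val_inj.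
by rewrite /= ei ej /bump; lia.
Qed.

Lemma coboundaryK n (a : X n -> F2) : coboundary (coboundary a) = 0.
Proof.
apply/funext => x; rewrite /coboundary pair_big /=.
rewrite (bigID (fun p : 'I_n.+3 * 'I_n.+2 => (p.2 < p.1)%N)) /=.
pose h (p : 'I_n.+3 * 'I_n.+2) : 'I_n.+3 * 'I_n.+2 :=
  (inord p.2, inord p.1.-1).
pose h' (p : 'I_n.+3 * 'I_n.+2) : 'I_n.+3 * 'I_n.+2 :=
  (inord p.2.+1, inord p.1).
have b1 (j : 'I_n.+3) := ltn_ord j; have b2 (j : 'I_n.+2) := ltn_ord j.
rewrite [X in _ + X = _](reindex_onto h h') /=; last first.
  move=> [j i] /= nlt; have := b1 j; have := b2 i => ? ?.
  by congr pair; apply/val_inj; rewrite /= !inordK; lia.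
have char2 (u v : 'F_2) : v = u -> u + v = 0.
  move=> ->; rewrite -mulr2n -[LHS]mulr_natl (_ : 2%:R = 0 :> 'F_2) ?mul0r //.
  exact/val_inj.
apply: char2.
apply: eq_big => [[j i]|[j i]] /=.
  have := b1 j; have := b2 i => ? ?.
  rewrite xpair_eqE -!val_eqE /=.
  by rewrite !inordK; lia.
rewrite xpair_eqE -!val_eqE => /and3P[H1 /= H2 _]; congr (a _); rewrite -!act_comp.
have := b1 j; have := b2 i => lti ltj.
case: (ltnP i j) => lij.
  by congr act; apply/esym/coface_coface => //; rewrite inordK; lia.
by move: H1 H2; rewrite !inordK; lia.
Qed.

Definition cochains : cochainComplex :=
  @CochainComplex (fun n => X n -> F2) (fun n => @coboundary n)
    (fun n a => coboundaryK a).

End Cochains.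

(* The basis element of N^vee(Delta^N) dual to the simplex x. *)
Definition dualSimplex N n (x : stdSimplex N n) : cochains (stdSimplex N) n :=
  fun y => (y == x :> incr n N)%:R.

Definition pullback (X Y : semiSimplicialSet) (f : semiSimplicialMap X Y) n
  (a : cochains Y n) : cochains X n := fun x => a (f n x).

(* The complex W.  The pair (a, b) is a + b T in the group ring of S_2,
   and W_i is the free module on e_i over it, in every degree i. *)

Definition W (i : nat) : lmodType 'F_2 := (F2 * F2)%type.

Definition Wgen i : W i := (1, 0).

(* Multiplication by T; the group ring is commutative. *)
Definition WT i (w : W i) : W i := (w.2, w.1).

(* The differential W_i -> W_(i-1), i.e. multiplication by 1 + T; the
   differential of W_0 is zero, so its dummy target is harmless. *)
Definition Wdiff i : W i -> W i.-1 :=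
  match i with 0 => fun _ => 0 | j.+1 => fun w => w + WT (i := j) w end.

Record Waut := WAut {
  wfun :> forall i, W i -> W i;
  wfun_linear : forall i, linear (wfun (i := i));
  wfun_T : forall i (w : W i), wfun (WT w) = WT (wfun w);
  wfun_diff : forall i (w : W i), Wdiff (wfun w) = wfun (Wdiff w);
  wfun_bij : forall i, bijective (wfun (i := i)) }.

(* Cup-i structures.  A chain map from the tensor product of W and
   A (x) A over the group ring to A is given by its components
   W_i x A^p x A^q -> A^n on elementary tensors: they are linear in each
   variable, balanced for the action of T, zero unless -n = i - p - q, and
   satisfy the Leibniz rule. *)

Record cupStructure (A : cochainComplex) := CupStructure {
  cup : forall i p q n, W i -> A p -> A q -> A n;
  cup_linearW : forall i p q n (a : A p) (b : A q),
    linear (fun w => cup (i := i) n w a b);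
  cup_linearl : forall i p q n (w : W i) (b : A q),
    linear (fun a : A p => cup n w a b);
  cup_linearr : forall i p q n (w : W i) (a : A p),
    linear (fun b : A q => cup n w a b);
  cup_T : forall i p q n (w : W i) (a : A p) (b : A q),
    cup n (WT w) a b = cup n w b a;
  cup_degree : forall i p q n (w : W i) (a : A p) (b : A q),
    (n + i)%N <> (p + q)%N -> cup n w a b = 0;
  cup_diff : forall i p q n (w : W i) (a : A p) (b : A q),
    dcomp (fun m => cup m w a b) n =
      cup n (Wdiff w) a b + cup n w (cdiff a) b + cup n w a (cdiff b) }.

(* The component in A^n of the cup-i product of a and b. *)
Definition cupi A (C : cupStructure A) i p q n (a : A p) (b : A q) : A n :=
  cup C n (Wgen i) a b.

Record cupConstruction := CupConstruction {
  cupOn :> forall X : semiSimplicialSet, cupStructure (cochains X);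
  cupOn_natural : forall (X Y : semiSimplicialSet) (f : semiSimplicialMap X Y)
      i p q n (w : W i) (a : cochains Y p) (b : cochains Y q),
    pullback f (cup (cupOn Y) n w a b) =
      cup (cupOn X) n w (pullback f a) (pullback f b) }.

(* An isomorphism is a natural family of automorphisms of W, one for each X;
   naturality for the maps from the empty semi-simplicial set makes them all
   equal. *)
Definition isomorphic (C D : cupConstruction) : Prop :=
  exists phi : Waut, forall (X : semiSimplicialSet) i p q n (w : W i)
      (a : cochains X p) (b : cochains X q),
    cup (C X) n (phi i w) a b = cup (D X) n w a b.

Definition isZeroConstruction (C : cupConstruction) : Prop :=
  forall (X : semiSimplicialSet) i p q n (w : W i)
      (a : cochains X p) (b : cochains X q),
    cup (C X) n w a b = 0.

Definition isNonZero (C : cupConstruction) : Prop := ~ isZeroConstruction C.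

Definition isIrreducible (C : cupConstruction) : Prop :=
  forall (i N n m p q : nat) (x : stdSimplex N n) (y : stdSimplex N m)
      (y1 : stdSimplex N p) (y2 : stdSimplex N q),
    vertices y \proper vertices x ->
    vertices y1 \subset vertices y -> vertices y2 \subset vertices y ->
    cupi (C (stdSimplex N)) i n (dualSimplex y1) (dualSimplex y2) x = 0.

Definition isFree (C : cupConstruction) : Prop :=
  forall (i N p q : nat) (x : stdSimplex N p) (x' : stdSimplex N q),
    p <> i \/ q <> i ->
    (forall n, cupi (C (stdSimplex N)) i n (dualSimplex x) (dualSimplex x') =
               cupi (C (stdSimplex N)) i n (dualSimplex x') (dualSimplex x)) ->
    forall n, cupi (C (stdSimplex N)) i n (dualSimplex x) (dualSimplex x') = 0.

(* The map N^vee(Delta^N) -> N^vee(Delta^M) induced on normalized cochains by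
   a map theta of the simplex category: the image under theta of a
   simplex is degenerate exactly when it is not strictly increasing, and then
   cochains vanish on it. *)
Definition simplicialPullback M N (theta : {ffun 'I_M.+1 -> 'I_N.+1}) n
    (a : cochains (stdSimplex N) n) : cochains (stdSimplex M) n :=
  fun x => if insub [ffun k => theta ((x : incr n M) k)] is Some y
           then a y else 0.

Definition isSimplicial (C : cupConstruction) : Prop :=
  forall (M N : nat) (theta : {ffun 'I_M.+1 -> 'I_N.+1}),
    (forall i j : 'I_M.+1, (i <= j)%N -> (theta i <= theta j)%N) ->
    forall i p q n (w : W i)
      (a : cochains (stdSimplex N) p) (b : cochains (stdSimplex N) q),
    simplicialPullback theta (cup (C (stdSimplex N)) n w a b) =
      cup (C (stdSimplex M)) n w
        (simplicialPullback theta a) (simplicialPullback theta b).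

(* Main.v *)
From HB Require Import structures.
From mathcomp Require Import all_boot all_order all_algebra.
From mathcomp Require Import boolp functions zify.
Require Import Defs.
Set Implicit Arguments.
Unset Strict Implicit.
Unset Printing Implicit Defensive.
Import GRing.Theory.
Local Open Scope ring_scope.

(* A construction is determined by the coefficients c_i(A, B) of the
   simplex with vertices A u B in the product of its faces A and B, where
   |A n B| = i + 1: irreducibility kills the other coefficients.  The Leibniz
   rule amounts to two families of relations: for a vertex k outside A u B,
     c_i(A, B) = c_i(A u k, B) + c_i(A, B u k),
   and, for |A n B| = i, the sum of c_i(A u v, B u v) over the vertices v of
   the symmetric difference of A and B is c_{i-1}(A, B) + c_{i-1}(B, A).
   With freeness, the first family forces c_i(A, B) to be 1 exactly when each
   vertex of the symmetric difference lies on a side prescribed by i and by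
   the number a of vertices of A n B below it; the second makes this side
   a + r_i mod 2.  The r_i are absorbed by the automorphisms of W, and r = 0
   gives Steenrod's product, for which the second family telescopes. *)

(** * Faces of a simplex *)

Lemma addF2K (u : F2) : u + u = 0.
Proof.
by rewrite -mulr2n -[LHS](mulr_natl (u : 'F_2)) (_ : 2%:R = 0 :> 'F_2) ?mul0r //; exact/val_inj.
Qed.

Lemma oppF2 (u : F2) : - u = u.
Proof. by apply/eqP; rewrite eq_sym -addr_eq0 addF2K. Qed.

Lemma addF2_eq0 (u v : F2) : (u + v == 0) = (u == v).
Proof. by rewrite addr_eq0 oppF2. Qed.

Lemma F2P (u : F2) : u = (u == 1)%:R.
Proof.
case: eqP => [-> //|] u1; apply: (val_inj : injective (val : 'F_2 -> nat)).
have u2 : (val (u : 'F_2) < 2)%N by exact: ltn_ord.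
have : val (u : 'F_2) <> 1 by move=> h; apply: u1; exact: val_inj.
by case: (val (u : 'F_2)) u2 => [|[|]].
Qed.

Lemma natrF2_addb (b1 b2 : bool) : (b1%:R + b2%:R : F2) = (b1 (+) b2)%:R.
Proof. by case: b1; case: b2; rewrite /= ?addF2K ?addr0 ?add0r. Qed.

Section Faces.
Variable N : nat.
Implicit Types (S A B : {set 'I_N.+1}).

Lemma incr_lt m n (y : incr m n) i j : (y i < y j)%N = (i < j)%N.
Proof.
have H := is_incrP _ (incr_prop y).
case: (ltngtP i j) => [/H//|/H|/ord_inj->]; last by rewrite ltnn.
by move=> h; apply/negbTE; rewrite -leqNgt ltnW.
Qed.

Lemma incr_inj m n (y : incr m n) : injective y.
Proof.
move=> i j e; apply/ord_inj; have := incr_lt y i j; have := incr_lt y j i.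
by rewrite e ltnn; case: ltngtP.
Qed.

Lemma mem_vertices n (y : incr n N) k : y k \in vertices y.
Proof. exact: imset_f. Qed.

Lemma card_vertices n (y : incr n N) : #|vertices y| = n.+1.
Proof. by rewrite card_imset ?card_ord //; exact: incr_inj. Qed.

Lemma card_ord_lt n (k : nat) : (k <= n)%N -> #|[set j : 'I_n | (j < k)%N]| = k.
Proof.
move=> kn; have -> : [set j : 'I_n | (j < k)%N] = [set widen_ord kn i | i : 'I_k].
  apply/setP => j; rewrite inE; apply/idP/imsetP => [jk|[i _ ->] /=//].
  by exists (Ordinal jk) => //; apply: val_inj.
by rewrite card_imset ?card_ord // => i j /(congr1 val) /= /ord_inj.
Qed.

(** This recovers the order of the vertices from the bare vertex set: [y k] is the vertex of the
    face with [k] vertices below it. Injectivity of [vertices] follows. *)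
Lemma card_below_face n (y : incr n N) k :
  #|[set u in vertices y | (u < y k)%N]| = k.
Proof.
rewrite -[RHS](@card_ord_lt n.+1 k) 1?ltnW //.
rewrite -(card_imset _ (@incr_inj _ _ y)); apply: eq_card => u.
apply/idP/idP => [|/imsetP[j]]; rewrite inE.
  by case/andP => /imsetP[j _ ->]; rewrite incr_lt => jk; rewrite imset_f ?inE.
by move=> jk ->; rewrite inE mem_vertices incr_lt.
Qed.

Lemma vertices_inj n : injective (fun y : incr n N => vertices y).
Proof.
move=> y z e; apply/val_inj/ffunP => k /=.
have : y k \in vertices z by rewrite -e mem_vertices.
case/imsetP => j _ ykE; have := card_below_face y k.
by rewrite ykE [vertices y]e card_below_face => /ord_inj ->.
Qed.

Lemma face_exists n S : #|S| = n.+1 -> exists y : incr n N, vertices y = S.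
Proof.
move=> cS.
have srt : sorted ltn [seq val i | i <- enum S].
  (* [enum S] is a filtered subsequence of [0, ..., N], hence increasing, so reading it off gives a
     map of the injective simplex category. *)
  have -> : [seq val i | i <- enum S] = [seq k <- iota 0 N.+1 | k \in [seq val i | i <- enum S]].
    rewrite -val_enum_ord filter_map; congr map.
    rewrite enumT [in LHS]/enum_mem; apply: eq_filter => i /=.
    by rewrite mem_map ?mem_enum //; exact: val_inj.
  exact/(sorted_filter ltn_trans)/iota_ltn_sorted.
pose f := [ffun k : 'I_n.+1 => nth ord0 (enum S) k].
have fi : is_incr f.
  apply/is_incrP => i j ij; rewrite !ffunE.
  have sz k : (k < n.+1)%N -> (k < size (enum S))%N by rewrite -cardE cS.
  rewrite -!(nth_map ord0 0%N val) ?sz //.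
  apply: (sorted_ltn_nth ltn_trans) => //; rewrite inE size_map sz //.
exists (Incr fi); apply/setP => v; apply/imsetP/idP => [[k _ ->]|vS].
  by rewrite /= ffunE -mem_enum mem_nth // -cardE cS.
have ix : (index v (enum S) < n.+1)%N by rewrite -cS cardE index_mem mem_enum.
by exists (Ordinal ix) => //; rewrite ffunE nth_index ?mem_enum.
Qed.

Lemma vertices_id : vertices (incr_id N) = setT.
Proof. by apply/setP => v; rewrite inE; apply/imsetP; exists v; rewrite ?ffunE. Qed.

End Faces.

Lemma vertices_comp l m n (f : incr m n) (g : incr l m) :
  vertices (incr_comp f g) = f @: vertices g.
Proof.
by rewrite /vertices -imset_comp; apply: eq_imset => i /=; rewrite ffunE.
Qed.

Lemma vertices_coface m n (y : incr m.+1 n) (j : 'I_m.+2) :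
  vertices (incr_comp y (coface j)) = vertices y :\ y j.
Proof.
apply/setP => v; rewrite !inE; apply/imsetP/andP => [[k _ ->]|[]].
  rewrite ffunE mem_vertices /= (inj_eq (@incr_inj _ _ y)) ffunE.
  by rewrite eq_sym neq_lift.
move=> vj /imsetP[k _ vE]; rewrite vE (inj_eq (@incr_inj _ _ y)) eq_sym in vj.
by have [k' kE _] := unlift_some vj; exists k' => //; rewrite !ffunE -kE.
Qed.

(* The value of [a] on the face of [x] spanned by [S], read as [0] when that
   face does not have the dimension of [a]. *)
Definition faceVal (X : semiSimplicialSet) p N (a : cochains X p) (x : X N)
    (S : {set 'I_N.+1}) : F2 :=
  \sum_(y : incr p N | vertices y == S) a (act y x).

Section FaceVal.
Variable X : semiSimplicialSet.

Lemma faceVal_vertices p N (a : cochains X p) (x : X N) (y : incr p N) :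
  faceVal a x (vertices y) = a (act y x).
Proof.
rewrite /faceVal (big_pred1 y) // => z.
by apply/eqP/eqP => [/vertices_inj|->].
Qed.

Lemma faceVal_dim p N (a : cochains X p) (x : X N) (S : {set 'I_N.+1}) :
  #|S| != p.+1 -> faceVal a x S = 0.
Proof.
by move=> cS; rewrite /faceVal big_pred0 // => y; apply: contraNF cS => /eqP <-;
   rewrite card_vertices.
Qed.

Lemma faceVal_id n (a : cochains X n) (x : X n) : faceVal a x setT = a x.
Proof. by rewrite -vertices_id faceVal_vertices act_id. Qed.

Lemma faceVal_act p m N (a : cochains X p) (x : X N) (y : incr m N) (S : {set 'I_m.+1}) :
  faceVal a (act y x) S = faceVal a x (y @: S).
Proof.
have [cS|cS] := eqVneq #|S| p.+1; last first.
  by rewrite !faceVal_dim // card_imset //; exact: incr_inj.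
have [z <-] := face_exists cS.
by rewrite -vertices_comp !faceVal_vertices act_comp.
Qed.

Lemma faceVal_linear p N (x : X N) (S : {set 'I_N.+1}) :
  linear (fun a : cochains X p => faceVal a x S : F2).
Proof.
by move=> k a b; rewrite /faceVal scaler_sumr -big_split.
Qed.

(** The [j]-th coface deletes the vertex [y j], so the coboundary becomes a sum over deleted
    vertices. In the wrong dimension both sides vanish, so no condition on [S] is required. *)
Lemma faceVal_cdiff p N (a : cochains X p) (x : X N) (S : {set 'I_N.+1}) :
  faceVal (cdiff a) x S = \sum_(v in S) faceVal a x (S :\ v).
Proof.
have [cS|cS] := eqVneq #|S| p.+2; last first.
  rewrite faceVal_dim // big1 // => v vS; apply: faceVal_dim.
  by apply: contraNneq cS => cv; rewrite (cardsD1 v) vS cv.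
have [y <-] := face_exists cS.
rewrite faceVal_vertices /= /coboundary [RHS]big_imset /=; last first.
  by move=> i j _ _; exact: incr_inj.
by apply: eq_big => //= j _; rewrite -vertices_coface faceVal_vertices act_comp.
Qed.

End FaceVal.

(** * The coefficients of the Steenrod products *)

Section Kappa.
Variable N : nat.
Implicit Types (A B I S : {set 'I_N.+1}) (u v k : 'I_N.+1).

Definition below I v := #|[set u in I | (u < v)%N]|.

Definition aligned A B v := (v \in B) == odd (below (A :&: B) v).

Definition allAligned A B :=
  [forall v, ((v \in A) != (v \in B)) ==> aligned A B v].

(** Steenrod's rule: the [i + 1] common vertices cut the order into [i + 2] intervals, whose
    remaining vertices go alternately to [A] only and [B] only, starting with [A]. For [i = 0] this
    is the Alexander-Whitney splitting into front and back faces. *)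
Definition steenrod i A B := (#|A :&: B| == i.+1) && allAligned A B.

Lemma belowU1 k I v : k \notin I -> below (k |: I) v = ((k < v) + below I v)%N.
Proof.
move=> kI; rewrite /below; case: ltnP => kv.
  have -> : [set u in k |: I | (u < v)%N] = k |: [set u in I | (u < v)%N].
    by apply/setP => u; rewrite !inE; case: eqVneq => // ->; rewrite kv.
  by rewrite cardsU1 inE (negbTE kI).
apply: eq_card => u; rewrite !inE; case: eqVneq => // ->.
by rewrite ltnNge kv (negbTE kI).
Qed.

Lemma setU1I k A B : k \notin B -> (k |: A) :&: B = A :&: B.
Proof.
by move=> kB; apply/setP => v; rewrite !inE; case: eqVneq => // ->; rewrite (negbTE kB) !andbF.
Qed.

(** Adding [k] to one side only leaves [A :&: B] unchanged, hence also the condition at every other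
    vertex; at [k] itself, exactly one of the two sides is aligned. *)
Lemma steenrod_split i A B k : k \notin A -> k \notin B ->
  (steenrod i A B)%:R =
    (steenrod i (k |: A) B)%:R + (steenrod i A (k |: B))%:R :> F2.
Proof.
move=> kA kB; rewrite /steenrod setU1I // [A :&: (k |: B)]setIC setU1I // setIC.
case: eqP => //= _; last by rewrite addr0.
have -> : allAligned (k |: A) B =
    allAligned A B && ~~ odd (below (A :&: B) k).
  apply/forallP/andP => [H|[/forallP H nk] v].
    split; last by have := H k; rewrite /aligned setU1I // !inE eqxx (negbTE kB).
    apply/forallP => v; have := H v; rewrite /aligned setU1I // !inE.
    by case: (eqVneq v k) => // ->; rewrite (negbTE kA) (negbTE kB).
  rewrite /aligned setU1I // !inE; case: (eqVneq v k) => [->|_]; last exact: H.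
  by rewrite (negbTE kB) (negbTE nk).
have -> : allAligned A (k |: B) = allAligned A B && odd (below (A :&: B) k).
  apply/forallP/andP => [H|[/forallP H nk] v].
    split; last first.
      have := H k; rewrite /aligned [A :&: _]setIC setU1I // !inE eqxx.
      by rewrite (negbTE kA) setIC => /eqP <-.
    apply/forallP => v; have := H v.
    rewrite /aligned [A :&: (k |: B)]setIC setU1I // [B :&: A]setIC !inE.
    by case: (eqVneq v k) => // ->; rewrite (negbTE kA) (negbTE kB).
  rewrite /aligned [A :&: _]setIC setU1I // !inE setIC.
  case: (eqVneq v k) => [->|_]; last exact: H.
  by rewrite nk implybT.
by rewrite natrF2_addb; case: allAligned; case: odd.
Qed.

(* The sum over [v] telescopes: moving the threshold [k] past [v] in [P k],
   which asks for alignment exactly below [k], changes [P] by the term of [v]. *)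
Lemma sum_steenrodU1 i A B : A != set0 -> B != set0 ->
  \sum_(v | (v \in A) != (v \in B)) (steenrod i (v |: A) (v |: B))%:R =
  match i return F2 with
  | 0%N => 0 | j.+1 => (steenrod j A B)%:R + (steenrod j B A)%:R
  end.
Proof.
move=> A0 B0; set I := A :&: B.
have UI v : (v |: A) :&: (v |: B) = v |: I by rewrite -setUIr.
have nI v : (v \in A) != (v \in B) -> v \notin I by rewrite inE; do 2!case: in_mem.
have [cI|cI] := eqVneq #|I| i; last first.
  rewrite big1 => [|v /nI vI]; last by rewrite /steenrod UI cardsU1 vI eqSS (negbTE cI).
  by case: i cI => [//|j] /negbTE cI; rewrite /steenrod [B :&: A]setIC cI addr0.
pose P (k : nat) := [forall v, ((v \in A) != (v \in B)) ==> (aligned A B v == (v < k)%N)].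
have step v : (if (v \in A) != (v \in B) then (steenrod i (v |: A) (v |: B))%:R else 0)
    = (P v.+1)%:R - (P v)%:R :> F2.
  rewrite oppF2 natrF2_addb.
  have Pother u : u != v -> (u < v.+1)%N = (u < v)%N.
    by move=> uv; rewrite ltnS leq_eqVlt; case: eqP => // /ord_inj e; rewrite e eqxx in uv.
  case: ifPn => [vAB|/negPn vAB]; last first.
    suff -> : P v.+1 = P v by rewrite addbb.
    apply: eq_forallb => u; have [->|uv] := eqVneq u v; first by rewrite vAB.
    by rewrite Pother.
  (* [Q] is the part shared by [P v] and [P v.+1]: these two differ only in the condition at [v],
     where they ask for opposite values. *)
  pose Q := [forall u, (((u \in A) != (u \in B)) && (u != v)) ==> (aligned A B u == (u < v)%N)].
  have QE b : Q && (aligned A B v == b) =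
      [forall u, ((u \in A) != (u \in B)) ==>
        (aligned A B u == if u == v then b else (u < v)%N)].
    apply/andP/forallP => [[/forallP H /eqP vb] u|H].
      by have := H u; case: (eqVneq u v) => [->|_]; rewrite ?vb ?eqxx ?implybT ?andbT.
    split; last by have := H v; rewrite vAB eqxx.
    apply/forallP => u; apply/implyP => /andP[uAB uv].
    by have := H u; rewrite uAB (negbTE uv).
  have -> : P v.+1 = Q && aligned A B v.
    rewrite -[aligned A B v]eqb_id QE; apply: eq_forallb => u.
    by have [->|uv] := eqVneq u v; rewrite ?ltnSn ?Pother.
  have -> : P v = Q && ~~ aligned A B v.
    rewrite -eqbF_neg QE; apply: eq_forallb => u.
    by have [->|uv] := eqVneq u v; rewrite ?ltnn.
  (* Making [v] a common vertex reverses the parity, hence the alignment, of exactly the vertices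
     above [v]; this turns full alignment into [Q]. *)
  suff -> : steenrod i (v |: A) (v |: B) = Q by case: (Q); case: aligned.
  rewrite /steenrod UI cardsU1 nI // cI eqxx /=; apply: eq_forallb => u.
  rewrite !inE; have [->|uv] := eqVneq u v; first by rewrite andbF.
  rewrite andbT /=; congr (_ ==> _).
  rewrite /aligned UI !inE (negbTE uv) /= belowU1 ?nI // oddD /=.
  have -> : (u < v)%N = ~~ (v < u)%N.
    by rewrite -leqNgt ltn_neqAle (inj_eq val_inj) uv.
  by case: (v < u)%N; case: (u \in B); case: (odd (below I u)).
rewrite big_mkcond /=.
rewrite (eq_bigr (fun v : 'I_N.+1 => (P v.+1)%:R - (P v)%:R : F2)) => [|v _]; last exact: step.
rewrite -(big_mkord xpredT (fun v : nat => (P v.+1)%:R - (P v)%:R : F2)) telescope_sumr //.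
(* The two ends of the telescope: everything aligned, and nothing aligned. The latter is alignment
   for the exchanged pair. *)
have -> : P N.+1 = allAligned A B.
  by apply: eq_forallb => u; rewrite ltn_ord eqb_id.
have -> : P 0%N = allAligned B A.
  apply: eq_forallb => u; rewrite ltn0 eq_sym eqbF_neg /aligned [B :&: A]setIC.
  by do 2!case: in_mem; case: odd.
rewrite oppF2.
case: i cI {step UI} => [|j] cI; last first.
  by rewrite /steenrod [B :&: A]setIC cI eqxx.
have I0 : I = set0 by apply/eqP; rewrite -cards_eq0 cI.
have below0 v : below I v = 0%N.
  by rewrite /below I0; apply: eq_card0 => u; rewrite !inE.
(* For [i = 0] there are no common vertices, so alignment would put every vertex on the first side,
   which a non-empty second face forbids. Both ends are then zero. *)
have F A' B' : A' :&: B' = I -> B' != set0 -> allAligned A' B' = false.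
  move=> IE /set0Pn[v vB]; apply/negbTE/forallPn; exists v.
  have : v \notin A' :&: B' by rewrite IE I0 inE.
  by rewrite inE vB andbT /aligned IE below0 vB => /negbTE->.
by rewrite (F A B) // (F B A) ?addr0 // setIC.
Qed.

End Kappa.

(** * The Leibniz rule on coefficients *)

Section Leibniz.
Variable N : nat.
Implicit Types (A B I S : {set 'I_N.+1}) (u v k : 'I_N.+1).

(** This is the coefficient of the face [S] in the product, along [w], of the cochains dual to [A]
    and [B]. The component [w.2] is the multiple of [T], hence the exchanged arguments. *)
Definition cupCoef i (w : W i) S A B : F2 :=
  if A :|: B == S
  then w.1 * (steenrod i A B)%:R + w.2 * (steenrod i B A)%:R else 0.

Lemma cupCoef_WT i (w : W i) S A B : cupCoef (WT w) S A B = cupCoef w S B A.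
Proof. by rewrite /cupCoef setUC; case: ifP => //= _; rewrite addrC. Qed.

Lemma cupCoef_linear i S A B : linear (fun w : W i => cupCoef w S A B).
Proof.
move=> k w w'; rewrite /cupCoef; case: ifP => _ /=; last by rewrite scaler0 addr0.
rewrite scalerDr !mulrDl -!scalerAl.
by rewrite !addrA; congr (_ + _); rewrite addrAC.
Qed.

Lemma setU1_coverN S A B k :
  k \in S -> k \notin A -> k \notin B ->
  ((k |: A) :|: B == S) = (A :|: B == S :\ k).
Proof.
move=> kS kA kB; rewrite -setUA; apply/eqP/eqP => [<-|->].
  by rewrite setU1K // inE negb_or kA.
by rewrite setD1K.
Qed.

(** There are three cases. If [A :|: B] is [S], the left side vanishes and [sum_steenrodU1] applies;
    if it misses one vertex [k] of [S], only [k] contributes and [steenrod_split] applies; otherwise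
    all terms vanish. *)
Lemma cupCoef_leibniz i (w : W i) S A B : A != set0 -> B != set0 ->
  \sum_(v in S) cupCoef w (S :\ v) A B =
    cupCoef (Wdiff w) S A B + \sum_(v | v \notin A) cupCoef w S (v |: A) B
    + \sum_(v | v \notin B) cupCoef w S A (v |: B).
Proof.
move=> A0 B0.
have [cov|ncov] := eqVneq (A :|: B) S.
  rewrite [LHS]big1 => [|v vS]; last first.
    by rewrite /cupCoef cov; case: eqP => // e; move: vS; rewrite e !inE eqxx.
  pose F v := w.1 * (steenrod i (v |: A) (v |: B))%:R + w.2 * (steenrod i (v |: B) (v |: A))%:R.
  (* Only [v] in [B] keeps the union equal to [S], and then [v |: B] is [B]. Together with the
     symmetric sum below, this gives the sum of [F] over the symmetric difference. *)
  have -> : \sum_(v | v \notin A) cupCoef w S (v |: A) B =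
            \sum_(v | (v \notin A) && (v \in B)) F v.
    rewrite (bigID (mem B)) /= [X in _ + X]big1 ?addr0 => [|v /andP[vA vB]].
      apply: eq_bigr => v /andP[vA vB].
      have vBE : v |: B = B by apply/setUidPr; rewrite sub1set.
      rewrite /cupCoef /F vBE -cov -setUA [v |: (_ :|: _)](setUidPr _) ?eqxx //.
      by rewrite sub1set inE vB orbT.
    rewrite /cupCoef; case: eqP => // e; have : v \in S by rewrite -e !inE eqxx.
    by rewrite -cov inE (negbTE vA) (negbTE vB).
  have -> : \sum_(v | v \notin B) cupCoef w S A (v |: B) =
            \sum_(v | (v \notin B) && (v \in A)) F v.
    rewrite (bigID (mem A)) /= [X in _ + X]big1 ?addr0 => [|v /andP[vB vA]].
      apply: eq_bigr => v /andP[vB vA].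
      have vAE : v |: A = A by apply/setUidPr; rewrite sub1set.
      rewrite /cupCoef /F vAE -cov setUCA [v |: (_ :|: _)](setUidPr _) ?eqxx //.
      by rewrite sub1set inE vA.
    rewrite /cupCoef; case: eqP => // e; have : v \in S by rewrite -e !inE eqxx orbT.
    by rewrite -cov inE (negbTE vA) (negbTE vB).
  rewrite -addrA (_ : \sum_(v | (v \notin A) && _) _ + _ =
    \sum_(v | (v \in A) != (v \in B)) F v); last first.
    rewrite [RHS](bigID (mem A)) /= addrC; congr (_ + _).
      by apply: eq_bigl => v; case: (v \in A); case: (v \in B).
    by apply: eq_bigl => v; case: (v \in A); case: (v \in B).
  rewrite /F big_split -!mulr_sumr sum_steenrodU1 //=.
  under [X in _ + (_ + w.2 * X)]eq_bigl => v do rewrite eq_sym.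
  rewrite sum_steenrodU1 // /cupCoef cov eqxx.
  case: i w {F} => [|i] w /=; first by rewrite !(mul0r, mulr0, addr0).
  set x := (_ %:R); set y := (_ %:R); rewrite [y + x]addrC -mulrDl.
  by rewrite [w.2 + w.1]addrC -mulrDr addF2K.
have [kS /=|none] := pickP [pred k in S | A :|: B == S :\ k].
  move=> /andP[kSS /eqP covk]; have := setD11 kS S; rewrite -covk inE.
  move/negbT; rewrite negb_or => /andP[kA kB].
  rewrite (bigD1 kS) //= big1 ?addr0 => [|v /andP[vS vk]]; last first.
    rewrite /cupCoef covk; case: eqP => // /setP/(_ v).
    by rewrite !inE eqxx vS vk.
  have Wd0 : cupCoef (Wdiff w) S A B = 0 by rewrite /cupCoef (negbTE ncov).
  rewrite Wd0 add0r (bigD1 kS) //= big1 ?addr0 => [|v /andP[vA vk]]; last first.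
    rewrite /cupCoef; case: eqP => // e; have := kSS.
    by rewrite -e !inE (negbTE kA) (negbTE kB) eq_sym (negbTE vk).
  rewrite (bigD1 kS) //= big1 ?addr0 => [|v /andP[vA vk]]; last first.
    rewrite /cupCoef; case: eqP => // e; have := kSS.
    by rewrite -e !inE (negbTE kA) (negbTE kB) eq_sym (negbTE vk).
  rewrite /cupCoef setU1_coverN // setUC in covk *.
  rewrite [A :|: _]setUC setU1_coverN // [B :|: A in X in if X then _ else _]setUC covk eqxx.
  rewrite (steenrod_split i kA kB) (steenrod_split i kB kA).
  by rewrite setUC covk eqxx [X in w.2 * X]addrC !mulrDr addrACA.
rewrite big1 => [|v vS]; last first.
  by rewrite /cupCoef; have := none v; rewrite /= vS /= => ->.
rewrite {1}/cupCoef (negbTE ncov) add0r !big1 ?addr0 // => v vA; rewrite /cupCoef; case: eqP => // e.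
  have vS : v \in S by rewrite -e !inE eqxx orbT.
  have [vA'|vA'] := boolP (v \in A).
    case/eqP: ncov; rewrite -e setUCA; apply/esym/setUidPr; rewrite sub1set.
    by rewrite inE vA'.
  by have := none v; rewrite /= vS -setU1_coverN // -e setUCA setUA eqxx.
have vS : v \in S by rewrite -e !inE eqxx.
have [vB'|vB'] := boolP (v \in B).
  case/eqP: ncov; rewrite -e -setUA; apply/esym/setUidPr; rewrite sub1set.
  by rewrite inE vB' orbT.
by have := none v; rewrite /= vS -setU1_coverN // e eqxx.
Qed.

End Leibniz.

(** * The Steenrod construction *)

Lemma imset_setT_face m N (y : incr m N) : y @: setT = vertices y.
Proof. by apply/setP => v; apply/imsetP/imsetP => -[k _ ->]; exists k. Qed.

Lemma below_incr m N (y : incr m N) (I : {set 'I_m.+1}) v : below (y @: I) (y v) = below I v.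
Proof.
rewrite /below -(card_imset _ (@incr_inj _ _ y)); apply: eq_card => u.
apply/idP/imsetP => [|[j]]; first rewrite inE.
  by case/andP => /imsetP[j jI ->]; rewrite incr_lt => jv; exists j; rewrite ?inE ?jI.
by move=> jP ->; rewrite inE in jP; case/andP: jP => jI jv; rewrite inE imset_f ?incr_lt.
Qed.

(** Alignment depends only on the relative order of the vertices, which [y] preserves; a vertex
    outside the image of [y] lies in neither set. *)
Lemma steenrod_incr i m N (y : incr m N) (A B : {set 'I_m.+1}) :
  steenrod i (y @: A) (y @: B) = steenrod i A B.
Proof.
have yI : injective y by exact: incr_inj.
rewrite /steenrod -imsetI; last by move=> *; exact: yI.
rewrite card_imset //; congr (_ && _); apply/forallP/forallP => H v.
  have := H (y v); rewrite !mem_imset // /aligned -imsetI; last by move=> *; exact: yI.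
  by rewrite below_incr mem_imset.
have [/imsetP[u _ ->]|vy] := boolP (v \in vertices y).
  rewrite !mem_imset // /aligned -imsetI; last by move=> *; exact: yI.
  by rewrite below_incr mem_imset.
have out (S : {set _}) : v \in y @: S = false.
  by apply: contraNF vy; apply: subsetP; apply: imsetS; exact/subsetP.
by rewrite !out.
Qed.

Lemma cupCoef_incr i (w : W i) m N (y : incr m N) (S A B : {set 'I_m.+1}) :
  cupCoef w (y @: S) (y @: A) (y @: B) = cupCoef w S A B.
Proof.
rewrite /cupCoef -imsetU !steenrod_incr (inj_eq (imset_inj _)) //.
exact: incr_inj.
Qed.

Lemma sum_imset m N (y : incr m N) (F : {set 'I_N.+1} -> F2) :
  (forall A : {set 'I_N.+1}, ~~ (A \subset vertices y) -> F A = 0) ->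
  \sum_A F A = \sum_(A : {set 'I_m.+1}) F (y @: A).
Proof.
move=> F0; rewrite (bigID (fun A : {set _} => A \subset vertices y)) /=.
rewrite [X in _ + X]big1 // addr0.
have yK (A : {set _}) : y @^-1: (y @: A) = A.
  by apply/setP => k; rewrite inE mem_imset //; exact: incr_inj.
rewrite (reindex_onto (fun A : {set 'I_m.+1} => y @: A) (fun A => y @^-1: A)) /=.
  by apply: eq_bigl => A; rewrite yK eqxx andbT; apply: imsetS; exact/subsetP.
move=> A /subsetP Ay; apply/setP => v; apply/imsetP/idP => [[k]|vA].
  by rewrite inE => kA ->.
by have /imsetP[k _ vE] := Ay _ vA; exists k => //; rewrite inE -vE.
Qed.

(** Summation by parts: it moves the coboundary from the cochains to the coefficients. *)
Lemma sum_setD1 N (G : {set 'I_N.+1} -> {set 'I_N.+1} -> F2) :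
  \sum_(A : {set 'I_N.+1}) \sum_(v in A) G A (A :\ v) =
  \sum_(A : {set 'I_N.+1}) \sum_(v | v \notin A) G (v |: A) A.
Proof.
rewrite (exchange_big_dep xpredT) // [RHS](exchange_big_dep xpredT) //=.
apply: eq_bigr => v _.
rewrite (reindex_onto (fun A : {set _} => v |: A) (fun A => A :\ v)) /=.
  apply: eq_big => A; first by rewrite setU11 /=; apply/eqP/idP => [<-|]; [rewrite setD11|exact: setU1K].
  by case/andP => _ /eqP->.
by move=> A vA; rewrite setD1K.
Qed.

Section SteenrodCup.
Variable X : semiSimplicialSet.

(** The product is evaluated on the face [S] of [x] but summed over subsets of the ambient simplex,
    so that the values on different faces of [x] share their index sets. *)
Definition cupVal i p q (w : W i) (a : cochains X p) (b : cochains X q)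
    N (x : X N) (S : {set 'I_N.+1}) : F2 :=
  \sum_A \sum_B cupCoef w S A B * (faceVal a x A * faceVal b x B).

Definition steenrodCup i p q n (w : W i) (a : cochains X p) (b : cochains X q) :
  cochains X n := fun x => cupVal w a b x setT.
Arguments steenrodCup {i p q} n w a b.

(** A non-zero coefficient needs [A :|: B] to be [y @: S], so only subsets of the face [y] enter the
    right-hand sum. *)
Lemma cupVal_incr i p q (w : W i) (a : cochains X p) (b : cochains X q)
    m N (y : incr m N) (x : X N) (S : {set 'I_m.+1}) :
  cupVal w a b (act y x) S = cupVal w a b x (y @: S).
Proof.
have sub A B : (A :|: B == y @: S) -> (A \subset vertices y) && (B \subset vertices y).
  by move/eqP => e; rewrite -subUset e imsetS //; exact/subsetP.
rewrite /cupVal (sum_imset (y := y)) => [|A nA]; last first.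
  rewrite big1 // => B _; rewrite /cupCoef; case: ifP; rewrite ?mul0r //.
  by move/sub; rewrite (negbTE nA).
apply: eq_bigr => A _; rewrite [RHS](sum_imset (y := y)) => [|B nB]; last first.
  rewrite /cupCoef; case: ifP; rewrite ?mul0r //.
  by move/sub; rewrite (negbTE nB) andbF.
by apply: eq_bigr => B _; rewrite cupCoef_incr !faceVal_act.
Qed.

Lemma faceVal_steenrodCup i p q n (w : W i) (a : cochains X p)
    (b : cochains X q) N (x : X N) (S : {set 'I_N.+1}) : #|S| = n.+1 ->
  faceVal (steenrodCup n w a b) x S = cupVal w a b x S.
Proof.
move=> cS; have [y <-] := face_exists cS.
rewrite faceVal_vertices /steenrodCup cupVal_incr; congr cupVal.
exact: imset_setT_face.
Qed.

Lemma steenrodCup_linearW i p q n (a : cochains X p) (b : cochains X q) :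
  linear (fun w : W i => steenrodCup n w a b).
Proof.
move=> k w w'; apply/funext => x; rewrite -[RHS]/(k *: cupVal w a b x setT + cupVal w' a b x setT).
rewrite /steenrodCup /cupVal scaler_sumr -big_split; apply: eq_bigr => A _.
rewrite scaler_sumr -big_split; apply: eq_bigr => B _ /=.
by rewrite cupCoef_linear mulrDl scalerAl.
Qed.

Lemma steenrodCup_linearl i p q n (w : W i) (b : cochains X q) :
  linear (fun a : cochains X p => steenrodCup n w a b).
Proof.
move=> k a a'; apply/funext => x; rewrite -[RHS]/(k *: cupVal w a b x setT + cupVal w a' b x setT).
rewrite /steenrodCup /cupVal scaler_sumr -big_split; apply: eq_bigr => A _.
rewrite scaler_sumr -big_split; apply: eq_bigr => B _ /=.
by rewrite faceVal_linear mulrDl mulrDr -scalerAl -scalerAr.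
Qed.

Lemma steenrodCup_T i p q n (w : W i) (a : cochains X p) (b : cochains X q) :
  steenrodCup n (WT w) a b = steenrodCup n w b a.
Proof.
apply/funext => x; rewrite /steenrodCup /cupVal exchange_big /=.
by apply: eq_bigr => A _; apply: eq_bigr => B _; rewrite cupCoef_WT [faceVal a _ _ * _]mulrC.
Qed.

Lemma steenrodCup_linearr i p q n (w : W i) (a : cochains X p) :
  linear (fun b : cochains X q => steenrodCup n w a b).
Proof.
move=> k b b'; rewrite -(steenrodCup_T n w (k *: b + b') a) steenrodCup_linearl.
by rewrite !steenrodCup_T.
Qed.

(** A non-zero term has [A] and [B] of sizes [p + 1] and [q + 1], with union of size [n + 1] and
    intersection of size [i + 1]; inclusion-exclusion gives the degree. *)
Lemma steenrodCup_degree i p q n (w : W i) (a : cochains X p) (b : cochains X q) :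
  (n + i)%N <> (p + q)%N -> steenrodCup n w a b = 0.
Proof.
move=> deg; apply/funext => x; rewrite /steenrodCup /cupVal; apply: big1 => A _.
apply: big1 => B _.
have [cA|cA] := eqVneq #|A| p.+1; last by rewrite faceVal_dim // mul0r mulr0.
have [cB|cB] := eqVneq #|B| q.+1; last by rewrite [faceVal b _ _]faceVal_dim // !mulr0.
suff -> : cupCoef w setT A B = 0 by rewrite mul0r.
rewrite /cupCoef; case: eqP => // e; rewrite /steenrod [B :&: A]setIC.
case: eqP => [cI|_]; last by rewrite !mulr0 addr0.
by have := cardsUI A B; rewrite e cA cB cI cardsT card_ord; lia.
Qed.

Lemma faceVal_set0 p N (a : cochains X p) (x : X N) : faceVal a x set0 = 0.
Proof. by rewrite faceVal_dim // cards0. Qed.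

Lemma dcomp_steenrodCup i p q n (w : W i) (a : cochains X p) (b : cochains X q) x :
  dcomp (fun m => steenrodCup m w a b) n x =
  \sum_(v in [set: 'I_n.+1]) cupVal w a b x (setT :\ v).
Proof.
(* In degree 0 the only deleted face is empty; it is covered only by empty [A] and [B], on which
   [faceVal] is zero. This agrees with the value 0 of [dcomp]. *)
case: n x => [|n] x /=.
  rewrite big1 // => v _; rewrite /cupVal big1 // => A _; rewrite big1 // => B _.
  rewrite /cupCoef; case: eqP => [e|_]; last by rewrite mul0r.
  suff -> : A = set0 by rewrite faceVal_set0 mul0r mulr0.
  apply/eqP; rewrite -subset0; apply/subsetP => u uA.
  have : u \in A :|: B by rewrite inE uA.
  by rewrite e [u]ord1 [v]ord1 !inE.
rewrite -[LHS]faceVal_id faceVal_cdiff; apply: eq_bigr => v _.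
apply: faceVal_steenrodCup; have := cardsD1 v [set: 'I_n.+2].
by rewrite in_setT cardsT card_ord => -[].
Qed.

Lemma steenrodCup_cdiffl i p q n (w : W i) (a : cochains X p) (b : cochains X q) x :
  steenrodCup n w (cdiff a) b x =
  \sum_(A : {set 'I_n.+1}) \sum_(B : {set 'I_n.+1})
    (\sum_(v | v \notin A) cupCoef w setT (v |: A) B) * (faceVal a x A * faceVal b x B).
Proof.
rewrite /steenrodCup /cupVal exchange_big [RHS]exchange_big /=; apply: eq_bigr => B _.
under eq_bigr => A _ do rewrite faceVal_cdiff mulr_suml mulr_sumr.
under [RHS]eq_bigr => A _ do rewrite mulr_suml.
exact: (sum_setD1 (fun A A' => cupCoef w setT A B * (faceVal a x A' * faceVal b x B))).
Qed.

Lemma steenrodCup_cdiffr i p q n (w : W i) (a : cochains X p) (b : cochains X q) x :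
  steenrodCup n w a (cdiff b) x =
  \sum_(A : {set 'I_n.+1}) \sum_(B : {set 'I_n.+1})
    (\sum_(v | v \notin B) cupCoef w setT A (v |: B)) * (faceVal a x A * faceVal b x B).
Proof.
rewrite /steenrodCup /cupVal; apply: eq_bigr => A _.
under eq_bigr => B _ do rewrite faceVal_cdiff mulr_sumr mulr_sumr.
under [RHS]eq_bigr => B _ do rewrite mulr_suml.
exact: (sum_setD1 (fun B B' => cupCoef w setT A B * (faceVal a x A * faceVal b x B'))).
Qed.

(** Once every term is a sum over the same pairs [A], [B], the identity is [cupCoef_leibniz] pair by
    pair; pairs with an empty member contribute nothing. *)
Lemma steenrodCup_diff i p q n (w : W i) (a : cochains X p) (b : cochains X q) :
  dcomp (fun m => steenrodCup m w a b) n =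
  steenrodCup n (Wdiff w) a b + steenrodCup n w (cdiff a) b
  + steenrodCup n w a (cdiff b).
Proof.
apply/funext => x; rewrite -[RHS]/(steenrodCup n (Wdiff w) a b x +
  steenrodCup n w (cdiff a) b x + steenrodCup n w a (cdiff b) x).
rewrite dcomp_steenrodCup steenrodCup_cdiffl steenrodCup_cdiffr /steenrodCup.
rewrite /cupVal exchange_big -!big_split /=; apply: eq_bigr => A _.
rewrite exchange_big -!big_split /=; apply: eq_bigr => B _.
rewrite -mulr_suml -!mulrDl.
have [->|A0] := eqVneq A set0; first by rewrite faceVal_set0 mul0r !mulr0.
have [->|B0] := eqVneq B set0; first by rewrite !faceVal_set0 !mulr0.
by rewrite cupCoef_leibniz.
Qed.

Definition steenrodStructure : cupStructure (cochains X) :=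
  @CupStructure (cochains X) (@steenrodCup) steenrodCup_linearW
    steenrodCup_linearl steenrodCup_linearr steenrodCup_T
    steenrodCup_degree steenrodCup_diff.

End SteenrodCup.

Lemma faceVal_pullback (X Y : semiSimplicialSet) (f : semiSimplicialMap X Y) p
    (a : cochains Y p) N (x : X N) (S : {set 'I_N.+1}) :
  faceVal (pullback f a) x S = faceVal a (f N x) S.
Proof. by apply: eq_bigr => y _; rewrite /pullback smap_act. Qed.

Lemma steenrod_natural (X Y : semiSimplicialSet) (f : semiSimplicialMap X Y)
    i p q n (w : W i) (a : cochains Y p) (b : cochains Y q) :
  pullback f (cup (steenrodStructure Y) n w a b) =
  cup (steenrodStructure X) n w (pullback f a) (pullback f b).
Proof.
apply/funext => x; rewrite /= /pullback /steenrodCup /cupVal.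
by apply: eq_bigr => A _; apply: eq_bigr => B _; rewrite !faceVal_pullback.
Qed.

Definition steenrodConstruction : cupConstruction := CupConstruction steenrod_natural.

(** * The axioms for the Steenrod construction *)

Lemma incr_1comp m n (x : incr m n) : incr_comp (incr_id n) x = x.
Proof. by apply/val_inj/ffunP => i; rewrite !ffunE. Qed.

Lemma faceVal_dual N p (y : stdSimplex N p) (A : {set 'I_N.+1}) :
  faceVal (dualSimplex y) (incr_id N : stdSimplex N N) A = (A == vertices y)%:R.
Proof.
have [cA|cA] := eqVneq #|A| p.+1; last first.
  rewrite faceVal_dim //; case: eqP => // e.
  by rewrite e card_vertices eqxx in cA.
have [z <-] := face_exists cA.
rewrite faceVal_vertices /dualSimplex /= incr_1comp.
by rewrite -(inj_eq (@vertices_inj _ _)).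
Qed.

Lemma sum_delta (T : finType) (F : T -> F2) t :
  \sum_s F s * (s == t)%:R = F t.
Proof.
rewrite (bigD1 t) //= eqxx mulr1 big1 ?addr0 // => s /negbTE->.
by rewrite mulr0.
Qed.

Lemma steenrod_dual N p q i n (w : W i) (y1 : stdSimplex N p)
    (y2 : stdSimplex N q) (z : stdSimplex N n) :
  cup (steenrodConstruction (stdSimplex N)) n w (dualSimplex y1) (dualSimplex y2) z
  = cupCoef w (vertices z) (vertices y1) (vertices y2).
Proof.
rewrite /= /steenrodCup.
have -> : z = act z (incr_id N : stdSimplex N N) by rewrite /= incr_1comp.
rewrite cupVal_incr imset_setT_face /cupVal /= incr_1comp.
under eq_bigr => A _ do under eq_bigr => B _ do rewrite !faceVal_dual mulrA.
by under eq_bigr => A _ do rewrite sum_delta; rewrite sum_delta.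
Qed.

Lemma steenrod_nonZero : isNonZero steenrodConstruction.
Proof.
pose x : stdSimplex 0 0 := incr_id 0.
move/(_ (stdSimplex 0) 0 0 0 0 (Wgen 0) (dualSimplex x) (dualSimplex x)).
move/(congr1 (fun f : cochains (stdSimplex 0) 0 => f x)).
rewrite steenrod_dual /cupCoef setUid eqxx /= mul1r mul0r addr0 /steenrod setIid.
rewrite card_vertices eqxx.
have -> : allAligned (vertices x) (vertices x).
  by apply/forallP => v; rewrite eqxx.
by move/eqP; rewrite oner_eq0.
Qed.

Lemma steenrod_irreducible : isIrreducible steenrodConstruction.
Proof.
move=> i N n m p q x y y1 y2 yx y1y y2y; rewrite /cupi steenrod_dual /cupCoef.
case: eqP => // e; have := proper_subn yx.
by rewrite -e subUset y1y y2y.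
Qed.

(** Where [A] and [B] differ, the two alignments would equate both memberships of [v] to the same
    parity. *)
Lemma steenrod_sym i N (A B : {set 'I_N.+1}) :
  steenrod i A B -> steenrod i B A -> A = B.
Proof.
case/andP => _ /forallP AB /andP[_ /forallP BA]; apply/setP => v; apply/eqP.
apply: contraT => nv; have := AB v; have := BA v.
rewrite eq_sym nv /aligned [B :&: A]setIC /= => /eqP vA /eqP vB.
by rewrite vA vB eqxx in nv.
Qed.

Lemma cupCoef_gen i N (S A B : {set 'I_N.+1}) :
  cupCoef (Wgen i) S A B = ((A :|: B == S) && steenrod i A B)%:R.
Proof. by rewrite /cupCoef; case: ifP => _ //=; rewrite mul1r mul0r addr0. Qed.

(** If a coefficient and its transpose are both 1, then [steenrod_sym] makes the two faces equal,
    with [i + 1] vertices; this is the case excluded by the dimension hypothesis. *)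
Lemma steenrod_free : isFree steenrodConstruction.
Proof.
move=> i N p q x x' pq sym n; apply/funext => z; rewrite /cupi.
have := congr1 (fun f : cochains (stdSimplex N) n => f z) (sym n).
rewrite /cupi !steenrod_dual !cupCoef_gen [_ x' :|: _]setUC.
case: eqP => //= _; case AB: steenrod => //; case BA: steenrod => // _.
have e := steenrod_sym AB BA; case/andP: AB; rewrite -e setIid card_vertices.
move=> /eqP[pi] _; have := card_vertices x'; rewrite -[vertices x']e card_vertices.
by case=> qp; case: pq; rewrite -?qp pi.
Qed.

(* Where [theta \o x] repeats a vertex, two adjacent vertices of [x] are
   identified; a non-zero term would have to put one of them in [A] only and
   the other in [B] only, but both have the same vertices of [A :&: B] below. *)
Lemma steenrod_simplicial : isSimplicial steenrodConstruction.
Proof.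
move=> M N theta mono i p q n w a b; apply/funext => x.
have act_face r (c : cochains (stdSimplex N) r) (A : {set 'I_n.+1}) (z : incr r n) :
    vertices z = A -> faceVal (simplicialPullback theta c) x A =
    if insub [ffun k => theta (x (z k))] is Some y then c y else 0.
  move=> <-; rewrite faceVal_vertices /simplicialPullback.
  by congr (if insub _ is Some y then _ else _); apply/ffunP => k; rewrite !ffunE.
rewrite [LHS]/simplicialPullback; case: insubP => [y _ yE|nx].
  rewrite /= /steenrodCup /cupVal; apply: eq_bigr => A _; apply: eq_bigr => B _.
  suff E r (c : cochains (stdSimplex N) r) S : faceVal c (y : stdSimplex N n) S =
      faceVal (simplicialPullback theta c) x S by rewrite !E.
  have [cS|cS] := eqVneq #|S| r.+1; last by rewrite !faceVal_dim.
  have [z zS] := face_exists cS; rewrite (act_face _ _ _ z zS) -zS faceVal_vertices /=.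
  case: insubP => [u _ uE|].
    congr c; apply: val_inj; rewrite uE; apply/ffunP => k.
    by rewrite !ffunE [incr_fun y]yE ffunE.
  case/negP; apply/is_incrP => j k jk; have := is_incrP _ (incr_prop (incr_comp y z)) j k jk.
  by rewrite !ffunE [incr_fun y]yE !ffunE.
(* By monotonicity, strict increase on consecutive vertices would give strict increase everywhere,
   so two consecutive vertices are identified. *)
have [k [k' [kk' thk]]] : exists k k' : 'I_n.+1, k' = k.+1 :> nat /\ theta (x k) = theta (x k').
  apply: contrapT => H; case/negP: nx; apply/is_incrP => j k jk; rewrite !ffunE.
  have lt1 (l l' : 'I_n.+1) : l' = l.+1 :> nat -> (theta (x l) < theta (x l'))%N.
    move=> ll'; rewrite ltn_neqAle mono ?andbT.
      by apply/eqP => /ord_inj e; apply: H; exists l, l'.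
    by rewrite ltnW // incr_lt ll'.
  have kj1 : (j.+1 < n.+1)%N by apply: leq_ltn_trans jk _.
  apply: leq_trans (lt1 j (Ordinal kj1) erefl) _; apply: mono.
  case: (ltngtP (Ordinal kj1) k) => [h|h|/ord_inj-> //].
    by rewrite ltnW // incr_lt.
  by move: h; rewrite /= ltnNge jk.
rewrite /= /steenrodCup /cupVal big1 // => A _; rewrite big1 // => B _.
have both r (c : cochains (stdSimplex N) r) (S : {set 'I_n.+1}) : k \in S -> k' \in S ->
    faceVal (simplicialPullback theta c) x S = 0.
  move=> kS k'S; have [cS|cS] := eqVneq #|S| r.+1; last by rewrite faceVal_dim.
  have [z zS] := face_exists cS; rewrite (act_face _ _ _ z zS).
  move: kS k'S; rewrite -zS => /imsetP[j _ jE] /imsetP[j' _ jE'].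
  case: insubP => // u /is_incrP /(_ j j'); rewrite -(incr_lt z) -jE -jE' kk' !ffunE.
  by rewrite -jE -jE' thk ltnn => /(_ (ltnSn _)).
have [/andP[kA k'A]|nA] := boolP ((k \in A) && (k' \in A)).
  by rewrite both // mul0r mulr0.
have [/andP[kB k'B]|nB] := boolP ((k \in B) && (k' \in B)).
  by rewrite [faceVal _ x B]both // !mulr0.
suff -> : cupCoef w setT A B = 0 by rewrite mul0r.
have cover U V : U :|: V = setT :> {set 'I_n.+1} -> ~~ ((k \in U) && (k' \in U)) ->
    ~~ ((k \in V) && (k' \in V)) -> steenrod i U V = false.
  move=> UV nU nV; apply/negP => /andP[_ /forallP al].
  have kUV := in_setT k; have k'UV := in_setT k'; move: kUV k'UV.
  rewrite -UV !inE => kUV k'UV.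
  (* If [k] were common, then [k'], which lies in [U] or [V], would share that set with [k]. So [k]
     and [k'] lie on opposite sides. *)
  have kI : k \in U :&: V = false.
    by rewrite inE; move: nU nV kUV k'UV; do 4!case: in_mem.
  have bel : below (U :&: V) k' = below (U :&: V) k.
    apply: eq_card => u; rewrite inE [in RHS]inE; have [->|uk] := eqVneq u k.
      by rewrite kI.
    by rewrite kk' ltnS leq_eqVlt (inj_eq val_inj) (negbTE uk).
  have := al k; have := al k'; rewrite /aligned bel.
  by move: nU nV kUV k'UV; do 4!case: in_mem => //=; case: odd.
rewrite /cupCoef; case: eqP => // AB; rewrite !cover ?mulr0 ?addr0 //.
by rewrite setUC.
Qed.

(** * Coefficients of a construction *)

Section LinearMaps.
Variables (U V : lmodType 'F_2) (f : U -> V).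
Hypothesis lf : linear f.

Lemma linear_fun0 : f 0 = 0.
Proof. by have := lf (-1) 0 0; rewrite scaler0 addr0 scaleN1r addNr. Qed.

Lemma linear_funD u v : f (u + v) = f u + f v.
Proof. by have := lf 1 u v; rewrite !scale1r. Qed.

Lemma linear_funZ k u : f (k *: u) = k *: f u.
Proof. by have := lf k u 0; rewrite !addr0 linear_fun0 addr0. Qed.

Lemma linear_fun_sum I r (P : pred I) (F : I -> U) :
  f (\sum_(i <- r | P i) F i) = \sum_(i <- r | P i) f (F i).
Proof. exact: (big_morph f linear_funD linear_fun0). Qed.

End LinearMaps.

Definition yoneda (X : semiSimplicialSet) n (x : X n) :
  semiSimplicialMap (stdSimplex n) X :=
  @SemiSimplicialMap (stdSimplex n) X (fun m (y : incr m n) => act y x)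
    (fun l m g y => act_comp y g x).

(** A dual simplex indexed by its vertex set. It is defined for all [p] and [A], and is zero unless
    [A] has [p + 1] elements. *)
Definition faceIndicator N p (A : {set 'I_N.+1}) : cochains (stdSimplex N) p :=
  fun y => (vertices y == A)%:R.
Arguments faceIndicator {N} p A.

Lemma dualSimplexE N p (y : stdSimplex N p) :
  dualSimplex y = faceIndicator p (vertices y).
Proof.
by apply/funext => z; rewrite /dualSimplex -(inj_eq (@vertices_inj _ _)).
Qed.

Lemma pullback_indicator m N (y : incr m N) p (A : {set 'I_m.+1}) :
  pullback (yoneda (y : stdSimplex N m)) (faceIndicator p (y @: A)) =
  faceIndicator p A.
Proof.
apply/funext => z; rewrite /pullback /faceIndicator /= vertices_comp.
by rewrite (inj_eq (imset_inj _)) //; exact: incr_inj.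
Qed.

Lemma pullback_indicator0 m N (y : incr m N) p (A : {set 'I_N.+1}) :
  ~~ (A \subset vertices y) ->
  pullback (yoneda (y : stdSimplex N m)) (faceIndicator p A) = 0.
Proof.
move=> nA; apply/funext => z; rewrite /pullback /faceIndicator /= vertices_comp.
by case: eqP nA => // <-; rewrite imsetS //; exact/subsetP.
Qed.

Lemma cdiff_indicator N p (A : {set 'I_N.+1}) :
  cdiff (faceIndicator p A) =
  \sum_(v | v \notin A) faceIndicator p.+1 (v |: A).
Proof.
apply/funext => y; rewrite fct_sumE /= /coboundary.
rewrite /faceIndicator /=; under eq_bigr => j _ do rewrite vertices_coface.
have yI : injective (y : incr _ _) by exact: incr_inj.
pose G v : F2 := (vertices y :\ v == A)%:R.
transitivity (\sum_(v in vertices y) G v).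
  by rewrite /vertices big_imset //= => i j _ _ /yI.
rewrite big_mkcond [RHS]big_mkcond; apply: eq_bigr => v _; rewrite /G.
have [vA|vA] /= := boolP (v \in A); case: ifP => // vy.
- by case: eqP => // e; move: vA; rewrite -e setD11.
- congr (_%:R); congr nat_of_bool; apply/eqP/eqP => [<-|->]; first by rewrite setD1K.
  by rewrite setU1K.
- by case: eqP => // e; move: vy; rewrite e setU11.
Qed.

Lemma pullback_yonedaE (X : semiSimplicialSet) p (a : cochains X p) n (x : X n) :
  pullback (yoneda x) a = \sum_A faceVal a x A *: faceIndicator p A.
Proof.
apply/funext => y; rewrite fct_sumE.
transitivity (\sum_A faceVal a x A * (A == vertices (y : incr p n))%:R).
  by rewrite sum_delta faceVal_vertices.
by apply: eq_bigr => A _; rewrite eq_sym.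
Qed.

Lemma card_succ (T : finType) (A : {set T}) : A != set0 -> exists n, #|A| = n.+1.
Proof. by rewrite -card_gt0; case: #|A| => // n _; exists n. Qed.

Section Coefficients.
Variable C : cupConstruction.

Lemma cup0l (A : cochainComplex) (D : cupStructure A) i p q n (w : W i) (b : A q) :
  cup D n w (0 : A p) b = 0.
Proof. exact: (linear_fun0 (cup_linearl D n w b)). Qed.

Lemma cup0r (A : cochainComplex) (D : cupStructure A) i p q n (w : W i) (a : A p) :
  cup D n w a (0 : A q) = 0.
Proof. exact: (linear_fun0 (cup_linearr D n w a)). Qed.

(* Coefficient of the face [S] in the cup-i product of [A] and [B]; meaningful
   only for non-empty sets, whose dimension is [#|_|.-1]. *)
Definition coef i N (S A B : {set 'I_N.+1}) : F2 :=
  faceVal (cupi (C (stdSimplex N)) i #|S|.-1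
    (faceIndicator #|A|.-1 A) (faceIndicator #|B|.-1 B))
    (incr_id N : stdSimplex N N) S.

Lemma coefE i N (S A B : {set 'I_N.+1}) n p q :
  #|S| = n.+1 -> #|A| = p.+1 -> #|B| = q.+1 ->
  coef i S A B = faceVal (cupi (C (stdSimplex N)) i n
    (faceIndicator p A) (faceIndicator q B)) (incr_id N : stdSimplex N N) S.
Proof. by rewrite /coef => -> -> ->. Qed.

Lemma coef_set0 i N (A B : {set 'I_N.+1}) : coef i set0 A B = 0.
Proof. exact: faceVal_set0. Qed.

Lemma faceVal_cup_face N n p q (y : incr n N) i (w : W i)
    (a : cochains (stdSimplex N) p) (b : cochains (stdSimplex N) q) m
    (S : {set 'I_n.+1}) :
  faceVal (cup (C (stdSimplex N)) m w a b) (incr_id N : stdSimplex N N) (y @: S) =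
  faceVal (cup (C (stdSimplex n)) m w (pullback (yoneda (y : stdSimplex N n)) a)
    (pullback (yoneda (y : stdSimplex N n)) b)) (incr_id n : stdSimplex n n) S.
Proof.
rewrite -cupOn_natural faceVal_pullback -faceVal_act; congr faceVal.
by rewrite /= incr_1comp incr_comp1.
Qed.

Lemma coef_incr i m N (y : incr m N) (S A B : {set 'I_m.+1}) :
  coef i (y @: S) (y @: A) (y @: B) = coef i S A B.
Proof.
have cy (U : {set _}) : #|y @: U| = #|U| by rewrite card_imset //; exact: incr_inj.
by rewrite /coef !cy /cupi faceVal_cup_face !pullback_indicator.
Qed.

(** Naturality along the map representing [x] reduces to a standard simplex; there both cochains are
    expanded in indicators and bilinearity applies. Thus the coefficients determine the
    construction. *)
Lemma cup_coef (X : semiSimplicialSet) i p q n (a : cochains X p)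
    (b : cochains X q) (x : X n) :
  cup (C X) n (Wgen i) a b x =
  \sum_A \sum_B coef i setT A B * (faceVal a x A * faceVal b x B).
Proof.
have -> : cup (C X) n (Wgen i) a b x =
    pullback (yoneda x) (cup (C X) n (Wgen i) a b) (incr_id n).
  by rewrite /pullback /= act_id.
rewrite cupOn_natural !pullback_yonedaE.
rewrite (linear_fun_sum (cup_linearl _ _ _ _)) fct_sumE; apply: eq_bigr => A _.
rewrite (linear_fun_sum (cup_linearr _ _ _ _)) fct_sumE; apply: eq_bigr => B _.
rewrite (linear_funZ (cup_linearl _ _ _ _)) (linear_funZ (cup_linearr _ _ _ _)).
have [cA|cA] := eqVneq #|A| p.+1; last first.
  by rewrite (faceVal_dim _ _ cA) mul0r mulr0 scale0r.
have [cB|cB] := eqVneq #|B| q.+1; last first.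
  by rewrite (faceVal_dim _ _ cB) !mulr0 scale0r scaler0.
rewrite (@coefE i n setT A B n p q) ?cardsT ?card_ord // faceVal_id.
by rewrite mulrC -mulrA.
Qed.

Lemma coef_leibniz i N (S A B : {set 'I_N.+1}) :
  S != set0 -> A != set0 -> B != set0 ->
  \sum_(v in S) coef i (S :\ v) A B =
    match i return F2 with 0%N => 0 | j.+1 => coef j S A B + coef j S B A end
    + \sum_(v | v \notin A) coef i S (v |: A) B
    + \sum_(v | v \notin B) coef i S A (v |: B).
Proof.
move=> /card_succ[n cS] /card_succ[p cA] /card_succ[q cB].
set id := incr_id N : stdSimplex N N.
have cD v : v \in S -> #|S :\ v| = n.
  by move=> vS; move: cS; rewrite (cardsD1 v) vS => -[].
have cU (U : {set 'I_N.+1}) r v : #|U| = r.+1 -> v \notin U -> #|v |: U| = r.+2.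
  by move=> cU vU; rewrite cardsU1 vU cU.
have := cup_diff (C (stdSimplex N)) n (Wgen i) (faceIndicator p A) (faceIndicator q B).
move/(congr1 (fun f : cochains (stdSimplex N) n => faceVal f id S)).
rewrite !(linear_funD (faceVal_linear _ _)) !cdiff_indicator.
rewrite (linear_fun_sum (cup_linearl _ _ _ _)) (linear_fun_sum (cup_linearr _ _ _ _)).
rewrite !(linear_fun_sum (faceVal_linear _ _)).
have -> : \sum_(v | v \notin A) faceVal (cup (C (stdSimplex N)) n (Wgen i)
      (faceIndicator p.+1 (v |: A)) (faceIndicator q B)) id S =
    \sum_(v | v \notin A) coef i S (v |: A) B.
  by apply: eq_bigr => v vA; rewrite (coefE i cS (cU _ _ _ cA vA) cB).
have -> : \sum_(v | v \notin B) faceVal (cup (C (stdSimplex N)) n (Wgen i)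
      (faceIndicator p A) (faceIndicator q.+1 (v |: B))) id S =
    \sum_(v | v \notin B) coef i S A (v |: B).
  by apply: eq_bigr => v vB; rewrite (coefE i cS cA (cU _ _ _ cB vB)).
have -> : faceVal (cup (C (stdSimplex N)) n (Wdiff (Wgen i))
      (faceIndicator p A) (faceIndicator q B)) id S =
    match i return F2 with 0%N => 0 | j.+1 => coef j S A B + coef j S B A end.
  case: i => [|j] /=.
    rewrite (linear_fun0 (cup_linearW _ _ _ _)).
    exact: (linear_fun0 (faceVal_linear _ _)).
  rewrite (linear_funD (cup_linearW _ _ _ _)) cup_T.
  by rewrite (linear_funD (faceVal_linear _ _)) (coefE j cS cA cB) (coefE j cS cB cA).
(* When [S] is a single vertex, the deleted face is empty and its coefficient is 0 by convention, as
   is [dcomp] in degree 0. *)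
move=> <-; case: n cS cD => [|n] cS cD /=.
  rewrite (linear_fun0 (faceVal_linear _ _)) big1 // => v vS.
  by rewrite (cards0_eq (cD _ vS)) coef_set0.
rewrite faceVal_cdiff; apply: eq_bigr => v vS.
by rewrite (coefE i (cD _ vS) cA cB).
Qed.

Hypothesis irr : isIrreducible C.

(** If [A] or [B] is not contained in [S], its indicator restricts to zero on [S]. Otherwise
    [A :|: B] is a proper face of [S] and irreducibility applies. *)
Lemma coef_cover i N (S A B : {set 'I_N.+1}) : A != set0 -> B != set0 ->
  A :|: B != S -> coef i S A B = 0.
Proof.
move=> A0 B0 nS; have [->|S0] := eqVneq S set0; first exact: coef_set0.
have [n cS] := card_succ S0; have [p cA] := card_succ A0.
have [q cB] := card_succ B0.
have [y yS] := face_exists cS; have [yA yAE] := face_exists cA.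
have [yB yBE] := face_exists cB.
rewrite (coefE i cS cA cB).
have [AS|AS] := boolP (A \subset S); last first.
  rewrite -yS -imset_setT_face /cupi faceVal_cup_face pullback_indicator0 ?yS //.
  by rewrite cup0l (linear_fun0 (faceVal_linear _ _)).
have [BS|BS] := boolP (B \subset S); last first.
  rewrite -yS -imset_setT_face /cupi faceVal_cup_face.
  rewrite [pullback _ (faceIndicator _ B)]pullback_indicator0 ?yS //.
  by rewrite cup0r (linear_fun0 (faceVal_linear _ _)).
have AB0 : A :|: B != set0 by rewrite setU_eq0 negb_and A0.
have [m cAB] := card_succ AB0; have [z zE] := face_exists cAB.
rewrite -yS faceVal_vertices -yAE -yBE -!dualSimplexE /= incr_1comp.
apply: (irr _ (y := z)); rewrite ?yAE ?yBE zE ?subsetUl ?subsetUr //.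
by rewrite properEneq yS nS subUset AS.
Qed.

Definition cupc i N (A B : {set 'I_N.+1}) := coef i (A :|: B) A B.

Lemma coef_cupc i N (S A B : {set 'I_N.+1}) : A != set0 -> B != set0 ->
  coef i S A B = if A :|: B == S then cupc i A B else 0.
Proof.
move=> A0 B0; case: eqVneq => [<- //|]; exact: coef_cover.
Qed.

Lemma cupc_degree i N (A B : {set 'I_N.+1}) : A != set0 -> B != set0 ->
  #|A :&: B| != i.+1 -> cupc i A B = 0.
Proof.
move=> A0 B0 cI; have AB0 : A :|: B != set0 by rewrite setU_eq0 negb_and A0.
have [n cS] := card_succ AB0; have [p cA] := card_succ A0.
have [q cB] := card_succ B0.
rewrite /cupc (coefE i cS cA cB) /cupi cup_degree.
  exact: (linear_fun0 (faceVal_linear _ _)).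
move=> deg; case/eqP: cI; have := cardsUI A B.
by rewrite cS cA cB; lia.
Qed.

Lemma cupc_incr i m N (y : incr m N) (A B : {set 'I_m.+1}) :
  cupc i (y @: A) (y @: B) = cupc i A B.
Proof. by rewrite /cupc -imsetU coef_incr. Qed.

(** The Leibniz rule at [k |: (A :|: B)]: by [coef_cover], each sum retains only [k], and the term
    of the differential of [e_i] vanishes. *)
Lemma cupc_split i N (A B : {set 'I_N.+1}) k : A != set0 -> B != set0 ->
  k \notin A -> k \notin B ->
  cupc i A B = cupc i (k |: A) B + cupc i A (k |: B).
Proof.
move=> A0 B0 kA kB; pose S := k |: (A :|: B).
have U0 (U : {set 'I_N.+1}) v : v |: U != set0 by apply/set0Pn; exists v; rewrite setU11.
have kS : k \in S by exact: setU11.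
have SD : S :\ k = A :|: B by rewrite setU1K // inE negb_or kA.
have nS : A :|: B != S by apply: contraTneq kS => <-; rewrite inE negb_or kA.
have := @coef_leibniz i N S A B (U0 _ _) A0 B0.
rewrite (bigD1 k) //= [X in _ + X]big1 ?addr0 => [|v /andP[vS vk]]; last first.
  apply: coef_cover => //; rewrite -SD; apply: contraNneq vk => /setP/(_ v).
  by rewrite !inE eqxx /=; move: vS; rewrite !inE => ->; rewrite andbT; case: eqP.
rewrite {1}SD -/(cupc i A B) => ->.
have -> : match i return F2 with 0%N => 0 | j.+1 => coef j S A B + coef j S B A end = 0.
  by case: (i) => // j; rewrite !coef_cover ?addr0 // setUC.
rewrite add0r (bigD1 k) //= big1 ?addr0 => [|v /andP[vA vk]]; last first.
  apply: coef_cover => //; apply: contraTneq kS => <-.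
  by rewrite !inE (negbTE kA) (negbTE kB) eq_sym (negbTE vk).
rewrite (bigD1 k) //= big1 ?addr0 => [|v /andP[vA vk]]; last first.
  apply: coef_cover => //; apply: contraTneq kS => <-.
  by rewrite !inE (negbTE kA) (negbTE kB) eq_sym (negbTE vk).
by rewrite /cupc -[k |: A :|: B]setUA [A :|: (k |: B)]setUCA.
Qed.

(** The Leibniz rule at [A :|: B] itself: no proper face of it is covered, so the left side
    vanishes, and an added vertex must already lie in the other set. *)
Lemma sum_cupcU1 i N (A B : {set 'I_N.+1}) : A != set0 -> B != set0 ->
  \sum_(v | (v \in A) != (v \in B)) cupc i (v |: A) (v |: B) =
  match i return F2 with 0%N => 0 | j.+1 => cupc j A B + cupc j B A end.
Proof.
move=> A0 B0; pose S := A :|: B.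
have U0 (U : {set 'I_N.+1}) v : v |: U != set0 by apply/set0Pn; exists v; rewrite setU11.
have S0 : S != set0 by rewrite setU_eq0 negb_and A0.
have Sin v : v \in S -> v |: S = S by move=> vS; apply/setUidPr; rewrite sub1set.
have := @coef_leibniz i N S A B S0 A0 B0.
rewrite big1 => [|v vS]; last first.
  by apply: coef_cover => //; apply/eqP => e; rewrite /S e setD11 in vS.
have -> : match i return F2 with 0%N => 0 | j.+1 => coef j S A B + coef j S B A end =
  match i return F2 with 0%N => 0 | j.+1 => cupc j A B + cupc j B A end.
  by case: (i) => // j; rewrite /cupc [B :|: A]setUC.
move/eqP; rewrite eq_sym -addrA addF2_eq0 => /eqP->.
rewrite (bigID (mem A)) /= addrC; congr (_ + _).
  rewrite [RHS](bigID (mem B)) /= [X in _ = _ + X]big1 ?addr0 => [|v /andP[vA vB]].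
    apply: eq_big => v; first by case: (v \in A); case: (v \in B).
    case/andP => vAB vA; have vB : v \in B by move: vAB; rewrite (negbTE vA); case: in_mem.
    rewrite coef_cupc // -setUA Sin ?inE ?vB ?orbT // eqxx.
    by rewrite [v |: B](setUidPr _) // sub1set.
  apply: coef_cover => //; apply/eqP => /setP/(_ v).
  by rewrite !inE eqxx (negbTE vA) (negbTE vB).
rewrite [RHS](bigID (mem A)) /= [X in _ = _ + X]big1 ?addr0 => [|v /andP[vB vA]].
  apply: eq_big => v; first by case: (v \in A); case: (v \in B).
  case/andP => vAB vA; have vB : v \notin B by move: vAB; rewrite vA; case: in_mem.
  rewrite coef_cupc // setUCA Sin ?inE ?vA // eqxx.
  by rewrite [v |: A](setUidPr _) // sub1set.
apply: coef_cover => //; apply/eqP => /setP/(_ v).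
by rewrite !inE eqxx (negbTE vA) (negbTE vB).
Qed.

Hypothesis free : isFree C.

(** Freeness compares whole products, but irreducibility leaves only the coefficient of [A :|: B].
    If both dimensions were [i], then [A] and [B] would equal their intersection, against
    [A != B]. *)
Lemma cupc_free i N (A B : {set 'I_N.+1}) : A != set0 -> B != set0 -> A != B ->
  cupc i A B = cupc i B A -> cupc i A B = 0.
Proof.
move=> A0 B0 nAB sym.
have [cI|] := eqVneq #|A :&: B| i.+1; last exact: cupc_degree.
have AB0 : A :|: B != set0 by rewrite setU_eq0 negb_and A0.
have [n cS] := card_succ AB0; have [p cA] := card_succ A0.
have [q cB] := card_succ B0.
have [yA yAE] := face_exists cA; have [yB yBE] := face_exists cB.
rewrite /cupc (coefE i cS cA cB) -yAE -yBE -!dualSimplexE free.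
- exact: (linear_fun0 (faceVal_linear _ _)).
- have [pA|] := eqVneq p i; last by left; apply/eqP.
  right => qB; case/eqP: nAB; rewrite pA in cA; rewrite qB in cB.
  have /eqP <- : A :&: B == A by rewrite eqEcard subsetIl cI cA leqnn.
  by apply/eqP; rewrite eqEcard subsetIr cI cB leqnn.
move=> m; apply/funext => z.
have ev p' q' (y1 : stdSimplex N p') (y2 : stdSimplex N q') :
    cupi (C (stdSimplex N)) i m (dualSimplex y1) (dualSimplex y2) z =
    coef i (vertices z) (vertices y1) (vertices y2).
  rewrite (@coefE _ _ _ _ _ m p' q') ?card_vertices // faceVal_vertices.
  by rewrite -!dualSimplexE /= incr_1comp.
by rewrite !ev !coef_cupc ?yAE ?yBE // [B :|: A]setUC sym.
Qed.

End Coefficients.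

(** * Classification *)

Section Classification.
Variable C : cupConstruction.
Hypotheses (irr : isIrreducible C) (free : isFree C).

Definition unitCoef : F2 := cupc C 0 [set: 'I_1] [set: 'I_1].

(** Induction on [i]: [sum_cupcU1] for [I] and [I :\ v] has the single term of [v], and [cupc_split]
    identifies its right side with the diagonal coefficient of [I :\ v]. *)
Lemma cupc_diag i N (I : {set 'I_N.+1}) : #|I| = i.+1 -> cupc C i I I = unitCoef.
Proof.
elim: i N I => [|i IH] N I cI.
  have [y <-] := face_exists cI.
  by rewrite -imset_setT_face (cupc_incr C).
have [v vI] : exists v, v \in I by apply/set0Pn; rewrite -card_gt0 cI.
have cJ : #|I :\ v| = i.+1 by move: cI; rewrite (cardsD1 v) vI => -[].
have J0 : I :\ v != set0 by rewrite -card_gt0 cJ.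
have I0 : I != set0 by rewrite -card_gt0 cI.
have vJ : v \notin I :\ v by rewrite setD11.
have := sum_cupcU1 irr i.+1 I0 J0.
rewrite (big_pred1 v) => [|u]; last first.
  by rewrite /= !inE; case: (eqVneq u v) => [->|]; rewrite ?vI //=; case: in_mem.
rewrite setD1K // (setUidPr _) ?sub1set // => ->.
by rewrite -(IH _ _ cJ) (cupc_split irr i J0 J0 vJ vJ) setD1K.
Qed.

Definition isRight i N (I : {set 'I_N.+1}) v : bool := cupc C i I (v |: I) == 1.

Definition matching i N (I D B : {set 'I_N.+1}) :=
  [forall (v | v \in D), (v \in B) == isRight i I v].

Lemma matching_split i N (I D B : {set 'I_N.+1}) v : v \in D -> v \notin B ->
  (matching i I D B)%:R + (matching i I D (v |: B))%:R =
  (matching i I (D :\ v) B)%:R :> F2.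
Proof.
move=> vD vB; rewrite natrF2_addb; congr (nat_of_bool _)%:R.
have E (B' : {set _}) (b : bool) : v \in B' = b -> (forall u, u != v -> u \in B' = (u \in B)) ->
    matching i I D B' = matching i I (D :\ v) B && (b == isRight i I v).
  move=> vB' uB'; apply/forallP/andP => [H|[/forallP H vr] u].
    split; last by have := H v; rewrite vD vB'.
    apply/forallP => u; apply/implyP; rewrite !inE => /andP[uv uD].
    by have := H u; rewrite uD uB'.
  apply/implyP => uD; have [->|uv] := eqVneq u v; first by rewrite vB'.
  by have := H u; rewrite !inE uv uD uB'.
rewrite (E B false) ?(negbTE vB) // (E (v |: B) true) ?setU11 //.
  by case: matching; case: isRight.
by move=> u uv; rewrite !inE (negbTE uv).
Qed.

(** For [D] disjoint from [I] and [B] inside [D], this parametrises a pair of faces by its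
    intersection [I], its symmetric difference [D], and the part [B] of [D] in the second face. *)
Definition splitCoef i N (I D B : {set 'I_N.+1}) :=
  cupc C i (I :|: (D :\: B)) (I :|: B).

Lemma splitCoef_split i N (I D B : {set 'I_N.+1}) v : I != set0 ->
  [disjoint D & I] -> B \subset D -> v \in D -> v \notin B ->
  splitCoef i I D B + splitCoef i I D (v |: B) = splitCoef i I (D :\ v) B.
Proof.
move=> I0 DI BD vD vB; rewrite /splitCoef.
have vI : v \notin I by rewrite (disjointFr DI vD).
have U0 (U : {set 'I_N.+1}) : I :|: U != set0 by rewrite setU_eq0 negb_and I0.
rewrite [RHS](@cupc_split _ irr _ _ _ _ v) //; first last.
- by rewrite inE negb_or vI.
- by rewrite !inE eqxx /= andbF orbF.
congr (_ + _); [congr (cupc C i _ _)|congr (cupc C i _ _)].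
- apply/setP => u; rewrite !inE; case: (eqVneq u v) => [->|//].
  by rewrite vD vB orbT.
- by apply/setP => u; rewrite !inE; case: (eqVneq u v) => [->|//]; rewrite /= andbF.
- by apply/setP => u; rewrite !inE; case: (eqVneq u v) => [->|//]; rewrite /= orbT.
Qed.

(** Exchanging the two faces replaces [B] by its complement in [D], and [D] non-empty makes the
    faces distinct; this is [cupc_free] in these terms. *)
Lemma splitCoef_free i N (I D B : {set 'I_N.+1}) : I != set0 ->
  [disjoint D & I] -> B \subset D -> D != set0 ->
  splitCoef i I D B = splitCoef i I D (D :\: B) -> splitCoef i I D B = 0.
Proof.
move=> I0 DI BD /set0Pn[v vD]; rewrite /splitCoef setDDr setDv set0U.
have /setIidPr -> := BD; move=> sym.
have U0 (U : {set 'I_N.+1}) : I :|: U != set0 by rewrite setU_eq0 negb_and I0.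
apply: (cupc_free irr free) => //; apply/eqP => /setP/(_ v).
by rewrite !inE (disjointFr DI vD) vD; case: in_mem.
Qed.

(* Both sides obey the same splitting relation, so their difference does not
   depend on [B]; freeness makes it vanish at one well-chosen [B]. *)
Lemma splitCoefE i N (I D B : {set 'I_N.+1}) : #|I| = i.+1 ->
  [disjoint D & I] -> B \subset D ->
  splitCoef i I D B = unitCoef * (matching i I D B)%:R.
Proof.
move=> cI; have I0 : I != set0 by rewrite -card_gt0 cI.
have [m] := ubnP #|D|; elim: m D B => // m IH D B cD DI BD.
have [D0|D0] := eqVneq D set0.
  have B0 : B = set0 by apply/eqP; rewrite -subset0 -D0.
  have -> : matching i I D B by apply/forallP => v; rewrite D0 inE.
  by rewrite mulr1 /splitCoef D0 B0 setD0 !setU0 cupc_diag.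
pose f B := splitCoef i I D B + unitCoef * (matching i I D B)%:R.
(* The values of [f] at [B'] and [v |: B'] add up to the same difference for [D :\ v], which is zero
   by induction. *)
have fU1 v (B' : {set 'I_N.+1}) : B' \subset D -> v \in D -> v \notin B' -> f (v |: B') = f B'.
  move=> BD' vD vB; apply/eqP; rewrite -addF2_eq0 /f addrACA -mulrDr.
  rewrite [splitCoef i I D (v |: B') + _]addrC splitCoef_split //.
  rewrite [X in unitCoef * X]addrC matching_split // IH ?addF2K //.
  - by move: cD; rewrite (cardsD1 v) vD add1n ltnS.
  - by apply: disjointWl DI; rewrite subsetDl.
  - by rewrite subsetD1 BD' vB.
have fconst (B' : {set 'I_N.+1}) : B' \subset D -> f B' = f set0.
  have [k] := ubnP #|B'|; elim: k B' => // k IHk B' cB' BD'.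
  have [->//|/set0Pn[v vB]] := eqVneq B' set0.
  have sub : B' :\ v \subset D by apply: subset_trans BD'; rewrite subsetDl.
  rewrite -(setD1K vB) fU1 ?setD11 ?(subsetP BD') // IHk //.
  by move: cB'; rewrite (cardsD1 v) vB add1n ltnS.
suff [B' BD' fB'] : exists2 B' : {set 'I_N.+1}, B' \subset D & f B' = 0.
  by apply/eqP; rewrite -addF2_eq0 -/(f B) fconst // -(fconst _ BD') fB'.
have [v vD] := set0Pn _ D0.
have [D1|D1] := eqVneq D [set v].
  exists [set v]; first by rewrite sub1set.
  have -> : f [set v] = (1 + unitCoef) * (isRight i I v)%:R.
    rewrite /f /splitCoef D1 setDv setU0 mulrDl mul1r; congr (_ + _ * _).
      by rewrite setUC [LHS]F2P.
    congr (nat_of_bool _)%:R; apply/forallP/idP => [/(_ v)|vR u].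
      by rewrite !inE eqxx => /eqP <-.
    by rewrite !inE; apply/implyP => /eqP->; rewrite eqxx vR.
  (* If the unit coefficient is 0, the coefficients with [v] on either side add up to 0, so they
     agree and freeness kills both. *)
  have [u1|u0] := eqVneq unitCoef 1; first by rewrite u1 addF2K mul0r.
  have {}u0 : unitCoef = 0 by rewrite [LHS]F2P (negbTE u0).
  suff E : splitCoef i I D [set v] = 0.
    have -> : isRight i I v = false; last by rewrite mulr0.
    move: E; rewrite /isRight /splitCoef D1 setDv setU0 setUC => ->.
    by rewrite eq_sym oner_eq0.
  apply: splitCoef_free => //; first by rewrite D1.
  have -> : D :\: [set v] = set0 by rewrite D1 setDv.
  have := @splitCoef_split i N I D set0 v I0 DI (sub0set _) vD.
  rewrite inE => /(_ isT); rewrite [RHS]IH ?sub0set //; first last.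
  - by apply: disjointWl DI; rewrite subsetDl.
  - by move: cD; rewrite (cardsD1 v) vD add1n ltnS.
  by rewrite u0 mul0r setU0 => /eqP; rewrite addF2_eq0 => /eqP.
have [u uD uv] : exists2 u, u \in D & u != v.
  have : ~~ (D \subset [set v]) by rewrite subset1 (negbTE D1) (negbTE D0).
  by case/subsetPn => u uD; rewrite inE; exists u.
(* [B'] follows the prescribed sides at [v] only. It therefore fails to match at [u], and its
   complement fails at [v]; as [f] takes equal values on both, so does [splitCoef]. *)
pose B' := [set x in D | isRight i I x == (x == v)].
have B'D : B' \subset D by apply/subsetP => x; rewrite inE => /andP[].
have m1 : matching i I D B' = false.
  apply/negP => /forallP/(_ u); rewrite !inE uD (negbTE uv).
  by case: isRight.
have m2 : matching i I D (D :\: B') = false.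
  apply/negP => /forallP/(_ v); rewrite !inE vD eqxx.
  by case: isRight.
exists B' => //; have := fconst _ (subsetDl D B'); rewrite -(fconst _ B'D).
rewrite /f m1 m2 mulr0 !addr0 => e; exact: splitCoef_free.
Qed.

Hypothesis nonZero : isNonZero C.

Lemma cupc_matching i N (A B : {set 'I_N.+1}) : A != set0 -> B != set0 ->
  #|A :&: B| = i.+1 ->
  cupc C i A B =
    unitCoef * [forall v, ((v \in A) != (v \in B)) ==>
      ((v \in B) == isRight i (A :&: B) v)]%:R.
Proof.
move=> A0 B0 cI; pose I := A :&: B; pose D := (A :|: B) :\: I.
have DI : [disjoint D & I] by rewrite -setI_eq0 setIDAC setDIl setDv setI0.
have AE : A = I :|: (D :\: (B :\: A)).
  by apply/setP => v; rewrite !inE; case: (v \in A); case: (v \in B).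
have BE : B = I :|: (B :\: A).
  by apply/setP => v; rewrite !inE; case: (v \in A); case: (v \in B).
have BD : B :\: A \subset D.
  by apply/subsetP => v; rewrite !inE; case: (v \in A); case: (v \in B).
rewrite [LHS](_ : _ = splitCoef i I D (B :\: A)); last first.
  by rewrite /splitCoef -AE -BE.
rewrite splitCoefE //.
congr (_ * (nat_of_bool _)%:R); apply: eq_forallb => v; rewrite !inE.
by case: (v \in A); case: (v \in B).
Qed.

Lemma cup_decomp (D : cupConstruction) (X : semiSimplicialSet) i p q n (w : W i)
    (a : cochains X p) (b : cochains X q) :
  cup (D X) n w a b = w.1 *: cup (D X) n (Wgen i) a b
                    + w.2 *: cup (D X) n (Wgen i) b a.
Proof.
have -> : w = w.1 *: Wgen i + w.2 *: WT (Wgen i).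
  case: w => w1 w2; congr pair; rewrite /=.
    by rewrite scaler0 addr0 [_ *: _]mulr1.
  by rewrite scaler0 add0r [_ *: _]mulr1.
rewrite (linear_funD (cup_linearW _ _ _ _)) !(linear_funZ (cup_linearW _ _ _ _)) cup_T /=.
by rewrite !scaler0 addr0 add0r ![_ *: (1 : F2)]mulr1.
Qed.

(** Every coefficient is a multiple of [unitCoef], so the value 0 would make the construction
    zero. *)
Lemma unitCoef1 : unitCoef = 1.
Proof.
have [//|u0] := eqVneq unitCoef 1; have {}u0 : unitCoef = 0 by rewrite [LHS]F2P (negbTE u0).
case: nonZero => X i p q n w a b.
have Z p' q' (a' : cochains X p') (b' : cochains X q') : cup (C X) n (Wgen i) a' b' = 0.
  apply/funext => x; rewrite cup_coef big1 // => A _; rewrite big1 // => B _.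
  have [->|A0] := eqVneq A set0; first by rewrite !faceVal_set0 mul0r mulr0.
  have [->|B0] := eqVneq B set0; first by rewrite !faceVal_set0 !mulr0.
  rewrite (coef_cupc irr) //; case: ifP; rewrite ?mul0r // => _.
  have [cI|cI] := eqVneq #|A :&: B| i.+1; last by rewrite cupc_degree ?mul0r.
  by rewrite cupc_matching // u0 !mul0r.
by rewrite cup_decomp !Z !scaler0 addr0.
Qed.

(** * Parity of the prescribed side *)

Definition rightAt i (a : 'I_i.+2) : bool := isRight i [set~ a] a.

Lemma setC1T (T : finType) (a : T) : a |: [set~ a] = setT.
Proof. exact: setUCr. Qed.

Lemma below_setC1 n (a : 'I_n.+1) : below [set~ a] a = a.
Proof.
rewrite -[RHS](@card_ord_lt n.+1 a) 1?ltnW //; apply: eq_card => u.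
by rewrite !inE; case: eqVneq => // ->; rewrite ltnn.
Qed.

(** Restriction to the face spanned by [I] and [v] leaves only the position of [v] in that face,
    which is the number of vertices of [I] below it. *)
Lemma isRightE i N (I : {set 'I_N.+1}) v (a : 'I_i.+2) : #|I| = i.+1 ->
  v \notin I -> a = below I v :> nat -> isRight i I v = rightAt a.
Proof.
move=> cI vI ae; have [y yE] : exists y : incr i.+1 N, vertices y = v |: I.
  by apply: face_exists; rewrite cardsU1 vI cI.
have /imsetP[k _ vk] : v \in vertices y by rewrite yE setU11.
have IE : I = y @: [set~ k].
  rewrite -[LHS](setU1K vI) -yE vk -imset_setT_face; apply/setP => u.
  apply/setD1P/imsetP => [[uk /imsetP[j _ uE]]|[j]].
    by exists j => //; rewrite !inE; apply: contraNneq uk => <-; rewrite uE.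
  rewrite !inE => jk ->; rewrite (inj_eq (@incr_inj _ _ y)) jk; split=> //.
  by rewrite imset_f.
have ka : k = a by apply: ord_inj; rewrite ae IE vk below_incr below_setC1.
rewrite /rightAt /isRight -yE -ka setC1T -[cupc C i [set~ k] _](cupc_incr C i y).
by rewrite -IE imset_setT_face.
Qed.

Lemma cupc_right i N (I : {set 'I_N.+1}) v : #|I| = i.+1 -> v \notin I ->
  cupc C i (v |: I) I = 1 + cupc C i I (v |: I).
Proof.
move=> cI vI; have I0 : I != set0 by rewrite -card_gt0 cI.
rewrite -unitCoef1 -(cupc_diag cI) (cupc_split irr i I0 I0 vI vI).
by rewrite -addrA addF2K addr0.
Qed.

(** Apply [sum_cupcU1] to the complements of [a'] and [a]. Its left side is
    [rightAt a' + rightAt a + 1] in [F2], and its right side vanishes. *)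
Lemma rightAtS i (a a' : 'I_i.+2) : a' = a.+1 :> nat -> rightAt a' = ~~ rightAt a.
Proof.
move=> aa'; have na : a != a' by rewrite -(inj_eq val_inj) /= aa' neq_ltn ltnSn.
have na' : a' != a by rewrite eq_sym.
pose A := [set~ a']; pose B := [set~ a].
have cC (k : 'I_i.+2) : #|[set~ k]| = i.+1 by rewrite cardsC1 card_ord.
have A0 : A != set0 by rewrite -card_gt0 cC.
have B0 : B != set0 by rewrite -card_gt0 cC.
have := sum_cupcU1 irr i A0 B0.
rewrite (bigD1 a) /=; last by rewrite !inE eqxx (negbTE na).
rewrite (big_pred1 a') => [|u /=]; last first.
  rewrite !inE; have [->|_] := eqVneq u a; first by rewrite andbF (negbTE na).
  by rewrite andbT; case: (u == a').
rewrite [a |: A](setUidPr _) ?sub1set ?inE // [a' |: B](setUidPr _) ?sub1set ?inE //.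
rewrite !setC1T.
have -> : cupc C i [set: 'I_i.+2] B = 1 + cupc C i B [set: 'I_i.+2].
  by have := @cupc_right i _ B a (cC a); rewrite !inE eqxx setC1T => ->.
(* Since [a] and [a'] are consecutive, the same common vertices lie below both, so one and the same
   side is prescribed for them; but they lie on opposite sides. *)
have -> : match i return F2 with 0%N => 0 | j.+1 => cupc C j A B + cupc C j B A end = 0.
  case: i a a' aa' na na' @A @B cC A0 B0 => [//|j] a a' aa' na na' A B cC A0 B0.
  have cI : #|A :&: B| = j.+1.
    have AB : A :|: B = setT.
      by apply/setP => u; rewrite !inE; case: (eqVneq u a) => [->|]; rewrite ?na /= ?orbT.
    by have := cardsUI A B; rewrite AB !cC cardsT card_ord; lia.
  have b1 : below (A :&: B) a = a.
    rewrite -[RHS](@card_ord_lt j.+3 a) 1?ltnW //; apply: eq_card => u.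
    rewrite !inE; have [->|ua] := eqVneq u a; first by rewrite ltnn andbF.
    have [->|//] := eqVneq u a'; rewrite /= aa'; lia.
  have b2 : below (A :&: B) a' = a.
    rewrite -[RHS](@card_ord_lt j.+3 a) 1?ltnW //; apply: eq_card => u.
    rewrite !inE aa' ltnS; have [->|ua] := eqVneq u a; first by rewrite ltnn andbF.
    have [->|ua'] := eqVneq u a'; first by rewrite /= aa'; lia.
    by rewrite leq_eqVlt (inj_eq val_inj) (negbTE ua).
  have aj : (a < j.+2)%N by rewrite -ltnS -aa'.
  have r1 : isRight j (A :&: B) a = rightAt (Ordinal aj).
    by apply: isRightE => //; rewrite !inE eqxx andbF.
  have r2 : isRight j (A :&: B) a' = rightAt (Ordinal aj).
    by apply: isRightE => //; rewrite !inE eqxx.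
  have Z (U V : {set 'I_j.+3}) : U != set0 -> V != set0 -> U :&: V = A :&: B ->
      (a \in U) != (a \in V) -> (a' \in U) != (a' \in V) -> (a \in V) != (a' \in V) ->
      cupc C j U V = 0.
    move=> U0 V0 UV aUV aUV' aV; rewrite cupc_matching ?UV // (_ : [forall v, _] = false) ?mulr0 //.
    apply/negP => /forallP H; have := H a; have := H a'.
    rewrite aUV aUV' /= r1 r2 => /eqP e1 /eqP e2; by rewrite e1 e2 eqxx in aV.
  by rewrite !Z ?addr0 // 1?setIC // !inE !eqxx ?(negbTE na) ?na'.
rewrite -[A]/[set~ a'] -[B]/[set~ a] addrCA.
rewrite [cupc C i [set~ a'] _]F2P [cupc C i [set~ a] _]F2P.
rewrite /rightAt /isRight !setC1T natrF2_addb.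
by case: (_ == 1); case: (_ == 1) => //= /eqP; rewrite ?addF2_eq0 ?addr0 ?oner_eq0.
Qed.

(** These are the [r_i] that remain free in each degree. *)
Definition flipped i : bool := rightAt (ord0 : 'I_i.+2).

Lemma rightAtE i (a : 'I_i.+2) : rightAt a = odd a (+) flipped i.
Proof.
case: a => a; elim: a => [|a IH] lt_a.
  by congr rightAt; exact: val_inj.
rewrite (@rightAtS i (Ordinal (ltnW lt_a))) // IH /=.
by rewrite addNb.
Qed.

(** Reversing the prescribed side of every vertex amounts to exchanging [A] and [B]. *)
Lemma cupc_steenrod i N (A B : {set 'I_N.+1}) : A != set0 -> B != set0 ->
  cupc C i A B = (if flipped i then steenrod i B A else steenrod i A B)%:R.
Proof.
move=> A0 B0; rewrite /steenrod [B :&: A]setIC.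
have [cI|cI] := eqVneq #|A :&: B| i.+1; last by rewrite cupc_degree // if_same.
rewrite cupc_matching // unitCoef1 mul1r /=.
have R v : (v \in A) != (v \in B) ->
    isRight i (A :&: B) v = odd (below (A :&: B) v) (+) flipped i.
  move=> vAB; have vI : v \notin A :&: B by rewrite inE; move: vAB; do 2!case: in_mem.
  have lt_b : (below (A :&: B) v < i.+2)%N.
    by rewrite ltnS -cI subset_leq_card //; apply/subsetP => u; rewrite inE => /andP[].
  by rewrite (@isRightE _ _ _ _ (Ordinal lt_b)) // rightAtE.
congr (nat_of_bool _)%:R; transitivity (if flipped i then allAligned B A else allAligned A B); last by case: flipped.
case fl: (flipped i); apply: eq_forallb => v.
  rewrite [(v \in B) == (v \in A)]eq_sym; case: (eqVneq (v \in A) (v \in B)) => //= vAB.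
  rewrite R // fl /aligned [B :&: A]setIC; move: vAB.
  by case: (v \in A); case: (v \in B) => //; case: odd.
by case: (eqVneq (v \in A) (v \in B)) => //= vAB; rewrite R // fl addbF.
Qed.

Definition twist (r : nat -> bool) i (w : W i) : W i := if r i then WT w else w.

Lemma cup_classification (X : semiSimplicialSet) i p q n (w : W i)
    (a : cochains X p) (b : cochains X q) :
  cup (C X) n w a b = cup (steenrodConstruction X) n (twist flipped w) a b.
Proof.
have E p' q' (a' : cochains X p') (b' : cochains X q') :
    cup (C X) n (Wgen i) a' b' =
    cup (steenrodConstruction X) n (twist flipped (Wgen i)) a' b'.
  apply/funext => x; rewrite cup_coef /= /steenrodCup /cupVal.
  apply: eq_bigr => A _; apply: eq_bigr => B _.
  have [->|A0] := eqVneq A set0; first by rewrite !faceVal_set0 mul0r !mulr0.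
  have [->|B0] := eqVneq B set0; first by rewrite !faceVal_set0 !mulr0.
  rewrite (coef_cupc irr) // cupc_steenrod // /twist; congr (_ * _).
  case: (flipped i); rewrite ?cupCoef_WT cupCoef_gen ?[B :|: A]setUC.
    by case: ifP.
  by case: ifP.
(* Since [e_i] generates [W i], agreement on it extends to all [w]. *)
rewrite cup_decomp [RHS]cup_decomp !E /twist; case: (flipped i) => //.
by rewrite !cup_T addrC.
Qed.

End Classification.

(** * Automorphisms of [W] and conclusion *)

Lemma WT_involutive i : involutive (@WT i).
Proof. by case. Qed.

Lemma twist_involutive r i : involutive (@twist r i).
Proof. by rewrite /twist => w; case: (r i); rewrite ?WT_involutive. Qed.

Lemma twist_linear r i : linear (@twist r i).
Proof.
have idl : linear (@id (W i)) by [].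
have WTl : linear (@WT i) by move=> k w w'; congr pair.
by rewrite /twist; case: (r i); [exact: WTl | exact: idl].
Qed.

Lemma twist_T r i (w : W i) : twist r (WT w) = WT (twist r w).
Proof. by rewrite /twist; case: (r i). Qed.

(** The choices in degrees [i] and [i - 1] are independent because multiplication by [T] fixes
    multiples of [1 + T]. *)
Lemma twist_diff r i (w : W i) : Wdiff (twist r w) = twist r (Wdiff w).
Proof.
have WTdiff j (u : W j) : WT (Wdiff u) = Wdiff u.
  case: j u => [//|j] [u1 u2]; congr pair; exact: addrC.
have diffWT j (u : W j) : Wdiff (WT u) = Wdiff u.
  case: j u => [//|j] [u1 u2]; congr pair; exact: addrC.
by rewrite /twist; case: (r i); case: (r i.-1); rewrite ?WTdiff ?diffWT.
Qed.

Definition twistAut (r : nat -> bool) : Waut :=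
  @WAut (@twist r) (@twist_linear r) (@twist_T r) (@twist_diff r)
    (fun i => inv_bij (@twist_involutive r i)).

Lemma twist_comp r s i (w : W i) :
  twist r (twist (fun j => r j (+) s j) w) = twist s w.
Proof. by rewrite /twist; case: (r i); case: (s i); rewrite ?WT_involutive. Qed.

Theorem mainTheorem1 :
  (exists C : cupConstruction, isNonZero C /\ isIrreducible C /\ isFree C) /\
  (forall C D : cupConstruction,
     isNonZero C -> isIrreducible C -> isFree C ->
     isNonZero D -> isIrreducible D -> isFree D ->
     isomorphic C D) /\
  (forall C : cupConstruction,
     isNonZero C -> isIrreducible C -> isFree C -> isSimplicial C).
Proof.
split; last split.
- exists steenrodConstruction; split; first exact: steenrod_nonZero.
  by split; [exact: steenrod_irreducible|exact: steenrod_free].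
- move=> C D C0 Cirr Cfree D0 Dirr Dfree.
  (* Both constructions are twists of Steenrod's, so the sum of the two twists carries one to the
     other. *)
  exists (twistAut (fun i => flipped C i (+) flipped D i)) => X i p q n w a b.
  rewrite (cup_classification Cirr Cfree C0) (cup_classification Dirr Dfree D0).
  by rewrite [twist _ _]twist_comp.
move=> C C0 Cirr Cfree M N theta mono i p q n w a b.
(* The twist affects only [w], while [isSimplicial] is quantified over all [w], so the property
   transfers. *)
by rewrite !(cup_classification Cirr Cfree C0) steenrod_simplicial.
Qed.
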